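(* Let $p$ be an odd prime, $n\ge 2$ an integer, and $A,k$ integers with $|A|<p/2$, $p\nmid A$, $1\le k<p-1$, $\gcd(k,p-1)=1$, and $k\notin\{1,(p+1)/2\}$ (i.e. $f$ is not of the form $Ax$ or $Ax^{(p+1)/2}$ mod $p$). Let $f(x)=Ax^k\bmod p$ (least positive residue), as a map on $I=\{1,\dots,p-1\}$, and for $0\le j\le n-1$ let $I_j=\{x:1\le x\le p-1,\ x\equiv j\pmod n\}$. If $$p>4\cdot 10^{29}\, n^{184/3},$$ then $f(I_i)\cap I_j\ne\emptyset$ for all $0\le i,j\le n-1$. *)

(* Defs.v *)
From mathcomp Require Import all_boot all_order all_algebra.
From mathcomp Require Import all_classical all_reals all_analysis.

Set Implicit Arguments.
Unset Strict Implicit.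
Unset Printing Implicit Defensive.

Import Order.TTheory GRing.Theory Num.Theory.

Local Open Scope classical_set_scope.
Local Open Scope ring_scope.

(* [modz] returns the representative in [0, p); it is nonzero, hence in
   {1, ..., p-1}, when p is a prime dividing neither A nor x. *)
Definition powmap (p : nat) (A : int) (k : nat) (x : int) : int :=
  ((A * x ^+ k) %% p%:Z)%Z.

Definition residue_class (p n j : nat) : set int :=
  [set x : int | 1 <= x <= p%:Z - 1 /\ (x = j%:Z %[mod n%:Z])%Z].

(* Main.v *)
From mathcomp Require Import all_boot all_order all_algebra all_field.
From mathcomp Require Import zify ring.

(** Put f x = (x, A x^k) in F_p^2 and let S u be its additive character sums.
    If x = i + n t, A x^k = j + n s has no solution with t, s short, then some
    nonzero frequency u has |S u| >> p / n^2.  Since S is invariant under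
    u -> (u_1 t, u_2 t^k), its fourth moment gives |S u|^4 <= p^3 (r + 1), where
    r bounds the number of roots of w^k + 1 = s (w + 1)^k.  This number is
    below p / (2^19 n^8) in two cases: if k a = b (mod p - 1) for some small a <> b, the
    substitution w = u y^a turns the equation into a polynomial one of small
    degree; if there is no small relation k a = b at all, Stepanov's method
    applies, with auxiliary polynomial sum A_jl(X) X^(kj mod p-1) (X+1)^(kl mod p-1),
    which is nonzero because its exponents are far apart.

    There remains k a = a (mod p - 1) with a small.  Then x^(k-1) takes at most a
    values, and on the fiber of the value d the map is x -> B x with B = A d.
    As k is neither 1 nor (p+1)/2, not all these B can be quotients of small
    integers: the quotients would form a periodic geometric progression of rationals,
    so its ratio would be 1 or -1.  For a B of large height, the points
    (t, B t) meet every box of side p / 4n, and a translate of this configuration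
    inside the fiber is found by bounding the character sums of the fiber by
    sqrt p. *)

Set Implicit Arguments.
Unset Strict Implicit.
Unset Printing Implicit Defensive.

Import Order.TTheory GRing.Theory Num.Theory.
Local Open Scope ring_scope.

Lemma ltn_Fp (p : nat) (p_prime : prime p) (x : 'F_p) : (x < p)%N.
Proof. exact: leq_trans (ltn_ord x) (eq_leq (Fp_cast p_prime)). Qed.

(** * Additive characters and Parseval's identity on F_p^m *)

Section Fourier.

Variables (p m : nat) (zeta : algC).
Hypotheses (p_prime : prime p) (zeta_prim : p.-primitive_root zeta).

Local Notation F := 'F_p.
Local Notation V := 'rV[F]_m.

Definition add_char (x : F) : algC := zeta ^+ x.

Lemma add_charD x y : add_char (x + y) = add_char x * add_char y.
Proof.
rewrite /add_char -exprD.
have -> : (x + y : F) = ((x + y) %% p)%N :> nat.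
  exact: (congr1 (modn (x + y)) (Fp_cast p_prime)).
by rewrite expr_mod ?(prim_expr_order zeta_prim).
Qed.

Lemma add_char0 : add_char 0 = 1. Proof. by rewrite /add_char expr0. Qed.

Lemma norm_add_char x : `|add_char x| = 1.
Proof.
rewrite /add_char normrX; have z1 : `|zeta| ^+ p = 1.
  by rewrite -normrX (prim_expr_order zeta_prim) normr1.
have/eqP := z1; rewrite pexpr_eq1 ?normr_ge0 ?prime_gt0 // => /eqP ->.
by rewrite expr1n.
Qed.

Lemma conj_add_char x : (add_char x)^* = add_char (- x).
Proof.
have nz : add_char x != 0 by rewrite -normr_eq0 norm_add_char oner_eq0.
apply: (mulfI nz); rewrite -add_charD subrr add_char0 -normCK norm_add_char.
by rewrite expr1n.
Qed.

Lemma add_char_neq1 x : x != 0 -> add_char x != 1.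
Proof.
move=> x0; rewrite /add_char -(prim_order_dvd zeta_prim).
apply: contra x0 => px; rewrite -val_eqE /=; apply/eqP.
have xp := ltn_Fp p_prime x.
by move: px; rewrite /dvdn modn_small // => /eqP.
Qed.

Definition dot (u v : V) : F := (u *m v^T) 0 0.

Lemma dotDl u u' v : dot (u + u') v = dot u v + dot u' v.
Proof. by rewrite /dot mulmxDl mxE. Qed.

Lemma dotDr u v v' : dot u (v + v') = dot u v + dot u v'.
Proof. by rewrite /dot linearD mulmxDr mxE. Qed.

Lemma dotNr u v : dot u (- v) = - dot u v.
Proof. by rewrite /dot linearN mulmxN mxE. Qed.

Lemma dot0l v : dot 0 v = 0. Proof. by rewrite /dot mul0mx mxE. Qed.
Lemma dot0r v : dot v 0 = 0. Proof. by rewrite /dot trmx0 mulmx0 mxE. Qed.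

(** Translating u by a vector [u0] with dot u0 v nonzero multiplies the sum by a character value
    other than 1, so the sum vanishes. *)
Lemma add_char_orthogonality (v : V) :
  \sum_u add_char (dot u v) = if v == 0 then #|{: V}|%:R else 0.
Proof.
have [->|v0] := eqVneq.
  under eq_bigr do rewrite dot0r add_char0.
  by rewrite sumr_const.
have [i vi] : exists i, v 0 i != 0.
  apply/existsP; apply: contraNT v0 => /existsPn h.
  by apply/eqP/rowP => i; rewrite mxE; apply/eqP; have := h i; rewrite negbK.
pose u0 : V := delta_mx 0 i.
have du0 : dot u0 v = v 0 i by rewrite /dot -rowE !mxE.
set s := \sum_u _; have : add_char (v 0 i) * s = s.
  rewrite /s mulr_sumr [RHS](reindex_inj (addrI u0)) /=; apply: eq_bigr => u _.
  by rewrite dotDl add_charD du0.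
move/eqP; rewrite -subr_eq0 -{2}[s]mul1r -mulrBl mulf_eq0 subr_eq0.
by rewrite (negPf (add_char_neq1 vi)) => /eqP.
Qed.

Definition char_sum (I : finType) (P : pred I) (f : I -> V) (u : V) : algC :=
  \sum_(i | P i) add_char (dot u (f i)).

Lemma char_sum0 (I : finType) (P : pred I) (f : I -> V) :
  char_sum P f 0 = #|P|%:R.
Proof.
rewrite /char_sum; under eq_bigr do rewrite dot0l add_char0.
by rewrite sumr_const.
Qed.

(** Orthogonality keeps exactly the pairs on which [f] collides. Allowing collisions is what later
    turns a fourth moment into a count of solutions. *)
Lemma parseval (I : finType) (P : pred I) (f : I -> V) :
  \sum_u `|char_sum P f u| ^+ 2 =
  (#|{: V}| * #|[pred ij : I * I | [&& P ij.1, P ij.2 & f ij.1 == f ij.2]]|)%:R.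
Proof.
transitivity (\sum_u \sum_(ij : I * I | P ij.1 && P ij.2)
   add_char (dot u (f ij.1 - f ij.2))).
  apply: eq_bigr => u _; rewrite normCK /char_sum raddf_sum /= big_distrlr /=.
  rewrite pair_big /=; apply: eq_bigr => -[i j] _ /=.
  by rewrite conj_add_char -add_charD dotDr dotNr.
rewrite exchange_big /=; under eq_bigr do rewrite add_char_orthogonality subr_eq0.
rewrite -big_mkcondr /= natrM sumr_const mulr_natr; congr (_ *+ _).
by apply: eq_card => -[i j]; rewrite !inE /= andbA.
Qed.

Lemma card_collision_inj (I : finType) (P : pred I) (f : I -> V) :
  {in P &, injective f} ->
  #|[pred ij : I * I | [&& P ij.1, P ij.2 & f ij.1 == f ij.2]]| = #|P|.
Proof.
move=> f_inj; rewrite -(card_imset P (f := fun i => (i, i))) => [|i j [] //].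
apply: eq_card => -[i j]; rewrite !inE /=; apply/idP/imsetP => [|[l Pl [-> ->]]].
  by case/and3P => Pi Pj /eqP /(f_inj _ _ Pi Pj) <-; exists i.
by rewrite -topredE /= in Pl; rewrite Pl eqxx.
Qed.

Lemma parseval_inj (I : finType) (P : pred I) (f : I -> V) :
  {in P &, injective f} ->
  \sum_u `|char_sum P f u| ^+ 2 = (#|{: V}| * #|P|)%:R.
Proof. by move=> f_inj; rewrite parseval card_collision_inj. Qed.

(* Large values propagate along a symmetry of the character sum. *)
Lemma char_sum_orbit (I J : finType) (P : pred I) (f : I -> V) (Q : pred J)
    (g : J -> V) (u : V) :
  {in Q &, injective g} ->
  (forall j, Q j -> char_sum P f (g j) = char_sum P f u) ->
  #|Q|%:R * `|char_sum P f u| ^+ 2 <=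
  (#|{: V}| * #|[pred ij : I * I | [&& P ij.1, P ij.2 & f ij.1 == f ij.2]]|)%:R.
Proof.
move=> g_inj gP; rewrite -parseval mulr_natl -sumr_const.
have -> : \sum_(i in Q) `|char_sum P f u| ^+ 2 =
          \sum_(j in Q) `|char_sum P f (g j)| ^+ 2.
  by apply: eq_bigr => j Qj; rewrite gP.
rewrite -(big_imset (fun v => `|char_sum P f v| ^+ 2)) //=.
rewrite [leRHS](bigID (mem [set g x | x in Q])) /= lerDl.
by apply: sumr_ge0 => i _; apply: exprn_ge0.
Qed.

(* The nonzero frequencies must cancel the main term when [f] misses [c + D + E]. *)
Lemma large_char_sum (I : finType) (P : pred I) (f : I -> V) (J : finType)
    (Q : pred J) (d e : J -> V) (c : V) :
  (0 < #|P|)%N -> (0 < #|Q|)%N ->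
  {in Q &, injective d} -> {in Q &, injective e} ->
  (forall i a b, P i -> Q a -> Q b -> f i != c + d a + e b) ->
  exists2 u, u != 0 &
    (#|P| * #|Q|)%:R <= #|{: V}|%:R * `|char_sum P f u|.
Proof.
move=> P0 Q0 d_inj e_inj nohit.
case: (pickP (fun u : V => (u != 0) &&
   ((#|P| * #|Q|)%:R <= #|{: V}|%:R * `|char_sum P f u|))) => [u /andP[]|small].
  by exists u.
exfalso.
(* The sum of [G] is |V| times the number of solutions of f i = c + d a + e b, hence 0, while G 0 =
   |P| |Q|^2 is the main term. *)
pose G u := char_sum P f u * add_char (dot u (- c)) *
  (char_sum Q d u)^* * (char_sum Q e u)^*.
have G_sum : \sum_u G u = 0.
  transitivity (\sum_u \sum_(i | P i) \sum_(a | Q a) \sum_(b | Q b)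
     add_char (dot u (f i - (c + d a + e b)))).
    apply: eq_bigr => u _; rewrite /G /char_sum !raddf_sum /= !mulr_suml.
    apply: eq_bigr => i _; rewrite -mulrA big_distrlr mulr_sumr /=.
    apply: eq_bigr => a _; rewrite mulr_sumr; apply: eq_bigr => b _.
    rewrite mulrA.
    rewrite !conj_add_char -!dotNr -!add_charD -!dotDr.
    by rewrite !opprD !addrA.
  rewrite exchange_big big1 // => i Pi; rewrite exchange_big big1 // => a Qa.
  rewrite exchange_big big1 // => b Qb.
  by rewrite add_char_orthogonality subr_eq0 (negPf (nohit i a b Pi Qa Qb)).
have G0 : G 0 = (#|P| * #|Q| * #|Q|)%:R.
  by rewrite /G !char_sum0 dot0l add_char0 mulr1 !conjC_nat !natrM.
have V0 : (0 < #|{: V}|)%N by apply/card_gt0P; exists 0.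
have le1 : #|{: V}|%:R * (#|P| * #|Q| * #|Q|)%:R <=
    \sum_(u | u != 0) (#|P| * #|Q|)%:R *
       ((`|char_sum Q d u| ^+ 2 + `|char_sum Q e u| ^+ 2) / 2).
  move/eqP: G_sum; rewrite (bigD1 0) //= addr_eq0 G0 => /eqP G_eq.
  rewrite -[(_ * _ * _)%:R]ger0_norm ?ler0n // G_eq normrN.
  apply: (le_trans (ler_wpM2l (ler0n _ _) (ler_norm_sum _ _ _))).
  rewrite mulr_sumr; apply: ler_sum => u u0.
  rewrite /G !normrM norm_add_char mulr1 !norm_conjC ![in leLHS]mulrA -[leLHS]mulrA.
  apply: ler_pM; rewrite ?mulr_ge0 ?ler0n //.
    have := small u; rewrite u0 /= => /negbT.
    by rewrite -real_ltNge ?realn ?realM ?normr_real ?realn //; apply: ltW.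
  rewrite ler_pdivlMr ?ltr0n // mulr_natr -subr_ge0.
  set x := `|_|; set y := `|_|.
  have -> : x ^+ 2 + y ^+ 2 - x * y *+ 2 = (x - y) ^+ 2 by rewrite sqrrB addrAC.
  by rewrite real_exprn_even_ge0 // realB ?normr_real.
(* Adding the positive term at u = 0 makes the bound strict; by Parseval both ends are then the same
   number, a contradiction. *)
have : \sum_(u | u != 0) (#|P| * #|Q|)%:R *
       ((`|char_sum Q d u| ^+ 2 + `|char_sum Q e u| ^+ 2) / 2) <
     \sum_u (#|P| * #|Q|)%:R *
       ((`|char_sum Q d u| ^+ 2 + `|char_sum Q e u| ^+ 2) / 2).
  rewrite [ltRHS](bigD1 0) //= ltrDr !char_sum0 normr_nat.
  apply: mulr_gt0; first by rewrite ltr0n muln_gt0 P0.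
  by rewrite divr_gt0 // addr_gt0 // exprn_gt0 // ltr0n.
rewrite -[ltRHS]mulr_sumr -mulr_suml big_split /= !parseval_inj // -mulr2n.
rewrite -[X in X / 2]mulr_natr mulfK ?pnatr_eq0 // => lt1.
have := le_lt_trans le1 lt1; rewrite -!natrM ltr_nat.
by rewrite [X in (_ < X)%N]mulnCA !mulnA ltnn.
Qed.

End Fourier.

(** * Sparse polynomials and multiplicities in characteristic p *)

Section SparsePolynomials.

Variables (F : fieldType) (p : nat).
Hypothesis pcharFp : p \in [pchar F].

Lemma natr_neq0_lt (n : nat) : (0 < n < p)%N -> n%:R != 0 :> F.
Proof.
case/andP=> n0 np; rewrite -(dvdn_pcharf pcharFp).
by apply/negP => /(dvdn_leq n0); rewrite leqNgt np.
Qed.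

Lemma natr_inj_lt (m n : nat) : (m < p)%N -> (n < p)%N ->
  m%:R = n%:R :> F -> m = n.
Proof.
wlog le_mn : m n / (m <= n)%N.
  by move=> h mp np; case: (leqP m n) => [|/ltnW] le e; [|apply/esym]; apply: h.
move=> mp np e; apply/eqP; rewrite eqn_leq le_mn /=.
case: leqP => // lt; have := @natr_neq0_lt (n - m).
by rewrite natrB // e subrr eqxx => /(_ ltac:(lia)).
Qed.

(* P |-> X P' - e P kills the monomial X^e and costs one factor X + 1. *)
Lemma sparse_poly_eq0 (E : seq nat) (P : {poly F}) :
  (forall i, P`_i != 0 -> i \in E) ->
  ('X + 1) ^+ size E %| P -> (size P <= p)%N -> P = 0.
Proof.
elim: E P => [|e E IH] P PE /=.
  by move=> _ _; apply/polyP => i; rewrite coef0; apply/eqP/contraT => /PE.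
move=> dvdP szP; have [ep|pe] := ltnP e p; last first.
  (* A monomial of degree at least p cannot occur in [P], so the exponent e is dropped. *)
  apply: IH => //; last by rewrite (dvdp_trans _ dvdP) // dvdp_exp2l.
  move=> i Pi; have := PE i Pi; rewrite inE => /orP [/eqP ie|//].
  by rewrite ie nth_default ?eqxx // (leq_trans szP) in Pi.
have coefE i : ('X * P^`() - e%:R%:P * P)`_i = (i%:R - e%:R) * P`_i.
  rewrite coefB coefXM coefCM coef_deriv.
  case: i => [|i] /=; first by rewrite mulr0n mulrBl mul0r.
  by rewrite mulrBl !mulr_natl.
have : 'X * P^`() - e%:R%:P * P = 0.
  apply: IH.
  - move=> i; rewrite coefE mulf_eq0 negb_or => /andP [ie /PE].
    rewrite inE => /orP [/eqP ei|//].
    by rewrite ei subrr eqxx in ie.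
  - apply: dvdp_sub; last by rewrite dvdp_mull // (dvdp_trans _ dvdP) // dvdp_exp2l.
    apply: dvdp_mull; case/dvdpP: dvdP => Q ->.
    rewrite derivM deriv_exp; apply: dvdp_add; first by rewrite dvdp_mull // dvdp_exp2l.
    by apply: dvdp_mull; rewrite -mulr_natl; do 2!apply: dvdp_mull.
  - apply/leq_sizeP => i /(leq_trans szP) pi; rewrite coefE nth_default ?mulr0 //.
move=> op0; have Pmon i : i != e -> P`_i = 0.
  move=> ie; case: (ltnP i (size P)) => [isz|]; last exact: nth_default.
  apply/eqP/negP => /negP Pi0; have /PE := Pi0; rewrite inE (negPf ie) /= => _.
  have := coefE i; rewrite op0 coef0 => /esym/eqP.
  rewrite mulf_eq0 (negPf Pi0) orbF subr_eq0 => /eqP ei.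
  by move/eqP: ie; apply; apply: natr_inj_lt ei => //; apply: leq_trans szP.
have PX : P = P`_e *: 'X^e.
  apply/polyP => i; rewrite coefZ coefXn; case: eqVneq => [->|ie].
    by rewrite mulr1.
  by rewrite mulr0 Pmon.
have : root P (-1).
  rewrite -dvdp_XsubCl polyCN opprK (dvdp_trans _ dvdP) //.
  by rewrite exprS dvdp_mulr.
rewrite /root PX hornerZ hornerXn mulf_eq0 signr_eq0 orbF => /eqP ->.
by rewrite scale0r.
Qed.

(** This derivation multiplies X^a (X + 1)^b by a (X + 1) + b X, so its iterates keep such powers as
    factors; away from 0 and -1 it detects multiplicities as d/dX does. *)
Definition euler_op (P : {poly F}) : {poly F} := 'X * ('X + 1) * P^`().

(** Each application lowers the order of vanishing at z by one and multiplies the value of the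
    cofactor by z (z + 1) times the current order, which is nonzero below p. *)
Lemma iter_euler_op_neq0 (z : F) (r : nat) (Q : {poly F}) :
  z != 0 -> z + 1 != 0 -> (r < p)%N -> Q.[z] != 0 ->
  (iter r euler_op (Q * ('X - z%:P) ^+ r)).[z] != 0.
Proof.
move=> z0 z1; elim: r Q => [|r IH] Q rp Qz; first by rewrite expr0 mulr1.
rewrite iterSr.
have -> : euler_op (Q * ('X - z%:P) ^+ r.+1) =
  ('X * ('X + 1) * (Q^`() * ('X - z%:P) + (r.+1)%:R%:P * Q)) * ('X - z%:P) ^+ r.
  rewrite /euler_op derivM deriv_exp derivB derivX derivC subr0 mul1r /=.
  rewrite -mulr_natl exprS polyC_natr /=; ring.
apply: IH; first exact: ltnW.
rewrite !(hornerM, hornerD, hornerX, hornerC, hornerN, hornerE) subrr mulr0 add0r.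
by rewrite !mulf_neq0 // natr_neq0_lt.
Qed.

Lemma dvdp_iter_euler_op (z : F) (M : nat) (P : {poly F}) :
  z != 0 -> z + 1 != 0 -> (M <= p)%N ->
  (forall m, (m < M)%N -> root (iter m euler_op P) z) ->
  ('X - z%:P) ^+ M %| P.
Proof.
move=> z0 z1 Mp Pz; have [->|P0] := eqVneq P 0; first exact: dvdp0.
have [r [Q]] := multiplicity_XsubC P z; rewrite P0 /= => Qz PQ.
case: (leqP M r) => [Mr|rM]; first by rewrite PQ dvdp_mull // dvdp_exp2l.
have := Pz r rM; rewrite PQ /root (negPf (iter_euler_op_neq0 _ _ _ _)) //.
exact: leq_trans rM Mp.
Qed.

Lemma dvdp_card_leq_size (Z : seq F) (M : nat) (P : {poly F}) :
  uniq Z -> P != 0 -> (forall z, z \in Z -> ('X - z%:P) ^+ M %| P) ->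
  (size Z * M < size P)%N.
Proof.
move=> uZ P0 ZP.
have : \prod_(z <- Z) ('X - z%:P) ^+ M %| P.
  elim: Z uZ ZP => [|z Z IH] /=; first by rewrite big_nil dvd1p.
  case/andP=> zZ uZ ZP; rewrite big_cons Gauss_dvdp.
    by rewrite ZP ?mem_head // IH // => w wZ; rewrite ZP // inE wZ orbT.
  rewrite big_seq; apply: (big_ind (fun q => coprimep _ q)); first exact: coprimep1.
    by move=> q r; rewrite coprimepMr => -> ->.
  move=> w wZ; apply/coprimep_expl/coprimep_expr.
  rewrite coprimep_XsubC root_XsubC; apply: contraNneq zZ => <-; exact: wZ.
move/dvdp_leq => /(_ P0); suff -> : size (\prod_(z <- Z) ('X - z%:P) ^+ M) =
  (size Z * M).+1 by [].
rewrite prodrXl -[LHS](@prednK _) ?size_exp ?size_prod_XsubC //.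
by rewrite size_poly_gt0 expf_neq0 // -size_poly_eq0 size_prod_XsubC.
Qed.

End SparsePolynomials.

(** Counting replaces linear algebra: some value is taken twice, and the difference of the two
    arguments lies in the kernel. *)
Lemma additive_kernel (F : finZmodType) (I J : finType)
    (f : {ffun I -> F} -> {ffun J -> F}) :
  (1 < #|F|)%N -> (#|J| < #|I|)%N -> {morph f : c d / c - d} ->
  exists2 c, c != 0 & f c = 0.
Proof.
move=> F1 JI fB; case: (pickP (fun cd => (cd.1 != cd.2) && (f cd.1 == f cd.2))).
  case=> c d /= /andP [cd /eqP fcd]; exists (c - d); first by rewrite subr_eq0.
  by rewrite fB fcd subrr.
move=> inj; have f_inj : injective f.
  move=> c d fcd; apply/eqP; have := inj (c, d).
  by rewrite /= fcd eqxx andbT => /negbFE.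
by have := leq_card f f_inj; rewrite !card_ffun leqNgt ltn_exp2l // JI.
Qed.

(** * The derivation acting in front of high powers of X and X + 1 *)

Section TwistedOperator.

Variables (F : fieldType) (N : nat) (kap : 'I_N -> nat).

(** The conjugate of [euler_op] by X^(kap j) (X + 1)^(kap l): the high powers stay aside, and the
    degree of the cofactor grows by at most one per step. *)
Definition twisted_op (j l : 'I_N) (P : {poly F}) : {poly F} :=
  euler_op P + ((kap j)%:R%:P * ('X + 1) + (kap l)%:R%:P * 'X) * P.

Lemma twisted_opB j l : {morph twisted_op j l : P Q / P - Q}.
Proof. by move=> P Q; rewrite /twisted_op /euler_op derivB; ring. Qed.

Lemma iter_twisted_opB j l m : {morph iter m (twisted_op j l) : P Q / P - Q}.
Proof. by elim: m => [|m IH] P Q //=; rewrite IH twisted_opB. Qed.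

Lemma euler_op_twisted j l (P : {poly F}) :
  euler_op (P * ('X^(kap j) * ('X + 1) ^+ kap l)) =
  twisted_op j l P * ('X^(kap j) * ('X + 1) ^+ kap l).
Proof.
have eX n : 'X * ('X^n)^`() = n%:R%:P * 'X^n :> {poly F}.
  rewrite derivXn -mulr_natl polyC_natr; case: n => [|n]; first by rewrite !mul0r mulr0.
  by rewrite mulrCA exprS.
have eX1 n : ('X + 1) * (('X + 1) ^+ n)^`() = n%:R%:P * ('X + 1) ^+ n :> {poly F}.
  rewrite deriv_exp derivD derivX -[1]/(1%:P) derivC addr0 mul1r -mulr_natl polyC_natr.
  by case: n => [|n]; [rewrite !mul0r mulr0 | rewrite mulrCA exprS].
rewrite /twisted_op /euler_op derivM derivM.
transitivity ('X * ('X + 1) * P^`() * ('X^(kap j) * ('X + 1) ^+ kap l) +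
  P * (('X * ('X^(kap j))^`()) * ('X + 1) * ('X + 1) ^+ kap l +
       (('X + 1) * (('X + 1) ^+ kap l)^`()) * 'X * 'X^(kap j))); first by ring.
rewrite eX eX1; ring.
Qed.

Lemma size_twisted_op j l (P : {poly F}) n :
  (size P <= n)%N -> (size (twisted_op j l P) <= n.+1)%N.
Proof.
move=> szP; apply/leq_sizeP => i ni.
have X1P (Q : {poly F}) k : (('X + 1) * Q)`_k = ('X * Q)`_k + Q`_k.
  by rewrite mulrDl mul1r coefD.
rewrite /twisted_op /euler_op mulrDl -!mulrA !coefD !coefCM coefXM.
case: i ni => // i ni /=; rewrite !X1P !coefXM /= !coef_deriv.
have z k : (n <= k)%N -> P`_k = 0 by move=> nk; rewrite nth_default // (leq_trans szP).
by case: i ni => [|i] ni /=; rewrite !z ?mul0rn ?addr0 ?mulr0 ?addr0 //; lia.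
Qed.

Lemma size_iter_twisted_op j l (P : {poly F}) n m :
  (size P <= n)%N -> (size (iter m (twisted_op j l) P) <= n + m)%N.
Proof.
by elim: m => [|m IH] szP; rewrite ?addn0 // addnS iterS size_twisted_op ?IH.
Qed.

Lemma iter_euler_op_sum (A : 'I_N -> 'I_N -> {poly F}) m :
  iter m (@euler_op F) (\sum_j \sum_l A j l * ('X^(kap j) * ('X + 1) ^+ kap l)) =
  \sum_j \sum_l iter m (twisted_op j l) (A j l) * ('X^(kap j) * ('X + 1) ^+ kap l).
Proof.
elim: m => // m IH; rewrite iterS IH /euler_op raddf_sum mulr_sumr.
apply: eq_bigr => j _; rewrite raddf_sum mulr_sumr; apply: eq_bigr => l _ /=.
by rewrite -/(euler_op _) euler_op_twisted.
Qed.

End TwistedOperator.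

(** * Independence of far apart powers of X and X + 1 over polynomials of small degree *)

Section Lacunary.

Variables (F : fieldType) (p M N : nat) (kap : 'I_N -> nat).
Hypotheses (pcharFp : p \in [pchar F]) (M_gt0 : (0 < M)%N) (MN : (4 * M < N)%N).
Hypothesis kap_sep : forall i j : 'I_N, i != j ->
  (kap i + N * M <= kap j)%N || (kap j + N * M <= kap i)%N.
Hypothesis kap_le : forall i, (kap i + N * M <= p)%N.

(** The windows [kap j, kap j + M) are disjoint, so the coefficients of each [A j] can be read off
    the sum; having at most N M exponents, the sum is 0 by [sparse_poly_eq0]. *)
Lemma lacunary_eq0 (A : 'I_N -> {poly F}) :
  (forall j, size (A j) <= M)%N ->
  ('X + 1) ^+ (N * M) %| \sum_j A j * 'X^(kap j) -> forall j, A j = 0.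
Proof.
move=> szA dvdA; set P := \sum_j _ in dvdA.
have coefP j (i : nat) : (i < M)%N -> P`_(kap j + i) = (A j)`_i.
  move=> iM; rewrite /P coef_sum (bigD1 j) //= coefMXn ltnNge leq_addr /=.
  rewrite addKn big1 ?addr0 // => j' jj'; rewrite coefMXn.
  case: ltnP => // le; rewrite nth_default // (leq_trans (szA j')) //.
  have MNM : (M <= N * M)%N by rewrite leq_pmull //; apply: leq_trans MN.
  have := kap_sep jj'; move: le iM MNM; move: (N * M)%N => NM; lia.
have P0 : P = 0.
  pose E := [seq (kap ji.1 + ji.2)%N | ji : 'I_N * 'I_M].
  apply: (sparse_poly_eq0 pcharFp (E := E)).
  - move=> e; rewrite /P coef_sum => Pe.
    have [j Aj] : exists j, (A j * 'X^(kap j))`_e != 0.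
      apply/existsP; apply: contraNT Pe => /existsPn h.
      by rewrite big1 // => j _; apply/eqP; have := h j; rewrite negbK.
    move: Aj; rewrite coefMXn; case: ltnP => [|le]; first by rewrite eqxx.
    move=> Aj; have eM : (e - kap j < M)%N.
      rewrite ltnNge; apply: contra Aj => Me.
      by rewrite nth_default // (leq_trans (szA j)).
    by apply/mapP; exists (j, Ordinal eM); rewrite ?mem_enum //= subnKC.
  - by rewrite size_map -cardE card_prod !card_ord.
  - apply: (leq_trans (size_sum _ _ _)); apply/bigmax_leqP => j _.
    apply: (leq_trans (size_polyMleq _ _)); rewrite size_polyXn.
    have := kap_le j; have := szA j.
    have MNM : (M <= N * M)%N by rewrite leq_pmull //; apply: leq_trans MN.
    move: MNM; move: (N * M)%N => NM; lia.
move=> j; apply/polyP => i; rewrite coef0.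
have [iM|Mi] := ltnP i M; first by rewrite -coefP // P0 coef0.
by rewrite nth_default // (leq_trans (szA j)).
Qed.

(** Among the l that occur, take the one with [kap l] least. If the sum were 0, its terms would be
    divisible by (X + 1)^(kap l + N M) like all the others, and [lacunary_eq0] would make them
    vanish. *)
Lemma bilacunary_neq0 (A : 'I_N -> 'I_N -> {poly F}) (j0 l0 : 'I_N) :
  (forall j l, size (A j l) <= M)%N -> A j0 l0 != 0 ->
  \sum_j \sum_l A j l * ('X^(kap j) * ('X + 1) ^+ kap l) != 0.
Proof.
move=> szA A0.
pose good l := [exists j, A j l != 0].
have good0 : good l0 by apply/existsP; exists j0.
case: (arg_minnP kap good0) => l gl lmin; apply/eqP => sum0.
case/existsP: gl => j /negP []; apply/eqP.
apply: (lacunary_eq0 (A := fun j => A j l)) => [i|]; first exact: szA.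
have X1 : ('X + 1 : {poly F}) ^+ kap l != 0.
  by rewrite expf_neq0 // -size_poly_eq0 size_XaddC.
rewrite -(dvdp_mul2l _ _ X1) -exprD.
have -> : ('X + 1) ^+ kap l * \sum_j A j l * 'X^(kap j) =
  - \sum_(l' | l' != l) \sum_j A j l' * ('X^(kap j) * ('X + 1) ^+ kap l').
  apply/eqP; rewrite -addr_eq0; apply/eqP; rewrite -[RHS]sum0 [RHS]exchange_big.
  rewrite [RHS](bigD1 l) //=; congr (_ + _); rewrite mulr_sumr.
  by apply: eq_bigr => i _; rewrite mulrC mulrA.
rewrite dvdpNr; apply: (big_ind (fun P => _ %| P)) => [|P Q|l' ll']; rewrite ?dvdp0 //.
  exact: dvdp_add.
apply: (big_ind (fun P => _ %| P)) => [|P Q|i _]; rewrite ?dvdp0 //; first exact: dvdp_add.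
have [->|A'] := eqVneq (A i l') 0; first by rewrite mul0r dvdp0.
have gl' : good l' by apply/existsP; exists i.
do 2!apply: dvdp_mull; apply: dvdp_exp2l.
have := lmin _ gl'; have := kap_sep ll'.
have : (0 < N * M)%N by rewrite muln_gt0 M_gt0 andbT; apply: leq_trans MN.
lia.
Qed.

End Lacunary.

(** * Stepanov's method *)

Section StepanovBound.

Variables (F : finFieldType) (p M N : nat) (kap : 'I_N -> nat).
Hypotheses (pcharFp : p \in [pchar F]) (M_gt0 : (0 < M)%N) (MN : (4 * M < N)%N).
Hypothesis kap_sep : forall i j : 'I_N, i != j ->
  (kap i + N * M <= kap j)%N || (kap j + N * M <= kap i)%N.
Hypothesis kap_le : forall i, (kap i + N * M <= p)%N.
Variables (Z : {set F}) (y : F -> F) (s : F).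
Hypothesis Mp : (M <= p)%N.
Hypothesis Z_neq0 : forall z, z \in Z -> (z != 0) && (z + 1 != 0).
Hypothesis Z_kap : forall z j, z \in Z -> z ^+ kap j = y z ^+ j.
Hypothesis Z1_kap : forall z l, z \in Z -> (z + 1) ^+ kap l = (s * (y z + 1)) ^+ l.

(** A nonzero auxiliary polynomial [Phi] of size at most 2 p is made to vanish to order M at every
    point of Z. *)
Lemma stepanov_bound : (#|Z| * M <= 2 * p)%N.
Proof.
pose A (c : {ffun 'I_M * 'I_N * 'I_N -> F}) (j l : 'I_N) : {poly F} :=
  \poly_(i < M) (if insub i is Some i then c (i, j, l) else 0).
have AB c d j l : A (c - d) j l = A c j l - A d j l.
  apply/polyP => i; rewrite coefB !coef_poly; case: ifP => [iM|]; last by rewrite subr0.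
  by rewrite insubT !ffunE.
have hornerX1 (z : F) : ('X + 1).[z] = z + 1 by rewrite !hornerE.
(* For z in Z, the product z^(kap j) (z + 1)^(kap l) is the value of this low degree polynomial at y
   z. *)
pose B (j l : 'I_N) : {poly F} := 'X^j * (s%:P * ('X + 1)) ^+ l.
have szB j l : (size (B j l) <= 2 * N)%N.
  apply: (leq_trans (size_polyMleq _ _)); rewrite size_polyXn /=.
  apply: (leq_trans (leq_add (leqnn _) (size_poly_exp_leq _ _))).
  have : (size (s%:P * ('X + 1) : {poly F})%R <= 2)%N.
    by rewrite mul_polyC (leq_trans (size_scale_leq _ _)) // size_XaddC.
  have := ltn_ord j; have := ltn_ord l.
  case: (size _) => [|[|[|//]]] /= *; lia.
(* One condition for each order m < M of derivation and each monomial z^a y^b, with z and y treated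
   as independent; m steps keep the degree in z below 2 M. *)
pose f c : {ffun 'I_M * 'I_(2 * M) * 'I_(2 * N) -> F} :=
  [ffun mab : 'I_M * 'I_(2 * M) * 'I_(2 * N) => \sum_(j < N) \sum_(l < N)
     (iter mab.1.1 (twisted_op kap j l) (A c j l))`_mab.1.2 * (B j l)`_mab.2].
have fB : {morph f : c d / c - d}.
  move=> c d; apply/ffunP => -[[m a] b]; rewrite !ffunE /= -sumrB.
  apply: eq_bigr => j _; rewrite -sumrB; apply: eq_bigr => l _.
  by rewrite AB iter_twisted_opB coefB mulrBl.
have [||c c0 fc] := additive_kernel _ _ fB.
- by rewrite (cardD1 0) (cardD1 1) !inE oner_eq0.
(* There are M N^2 unknowns and 4 M^2 N conditions. *)
- rewrite !card_prod !card_ord; nia.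
have szA j l : (size (A c j l) <= M)%N by exact: size_poly.
set Phi := \sum_j \sum_l A c j l * ('X^(kap j) * ('X + 1) ^+ kap l).
have Phi0 : Phi != 0.
  have [[[i j] l] ci] : exists ijl, c ijl != 0.
    apply/existsP; apply: contraNT c0 => /existsPn h.
    by apply/eqP/ffunP => ijl; rewrite ffunE; apply/eqP; have := h ijl; rewrite negbK.
  apply: (bilacunary_neq0 pcharFp M_gt0 MN kap_sep kap_le (A := A c) (j0 := j) (l0 := l)) => //.
  apply: contraNneq ci => Ajl; have := congr1 (fun P : {poly F} => P`_i) Ajl.
  by rewrite coef_poly ltn_ord coef0 valK => /eqP.
have PhiZ z : z \in Z -> ('X - z%:P) ^+ M %| Phi.
  move=> zZ; have /andP [z0 z1] := Z_neq0 zZ.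
  apply: (dvdp_iter_euler_op pcharFp) => // m mM; rewrite iter_euler_op_sum /root.
  rewrite horner_sum.
  have -> : \sum_j (\sum_l iter m (twisted_op kap j l) (A c j l) *
        ('X^(kap j) * ('X + 1) ^+ kap l)).[z] =
     \sum_(j < N) \sum_(l < N) \sum_(a < 2 * M) \sum_(b < 2 * N)
       (z ^+ a * y z ^+ b) *
       ((iter m (twisted_op kap j l) (A c j l))`_a * (B j l)`_b).
    apply: eq_bigr => j _; rewrite horner_sum; apply: eq_bigr => l _.
    rewrite !hornerM hornerXn horner_exp hornerX1 Z_kap // Z1_kap //.
    have -> : y z ^+ j * (s * (y z + 1)) ^+ l = (B j l).[y z].
      by rewrite /B hornerM hornerXn horner_exp hornerM hornerC hornerX1.
    rewrite (@horner_coef_wide _ (2 * M)); last first.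
      by rewrite (leq_trans (size_iter_twisted_op kap j l m (szA j l))) //; lia.
    rewrite (@horner_coef_wide _ (2 * N)) // big_distrlr /=.
    by apply: eq_bigr => a _; apply: eq_bigr => b _; ring.
  apply/eqP; under eq_bigr => j _ do rewrite exchange_big.
  rewrite exchange_big big1 // => a _.
  under eq_bigr => j _ do rewrite exchange_big.
  rewrite exchange_big big1 // => b _.
  have := congr1 (fun g : {ffun _ -> F} => g (Ordinal mM, a, b)) fc.
  rewrite !ffunE /= => h.
  transitivity (z ^+ a * y z ^+ b * \sum_(j < N) \sum_(l < N)
    (iter m (twisted_op kap j l) (A c j l))`_a * (B j l)`_b); last by rewrite h mulr0.
  by rewrite mulr_sumr; apply: eq_bigr => j _; rewrite mulr_sumr.
have := @dvdp_card_leq_size _ (enum Z) M Phi (enum_uniq _) Phi0.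
rewrite -cardE => /(_ _) /ltnW h; apply: (leq_trans (h _)) => [z|].
  by rewrite mem_enum; apply: PhiZ.
apply: (leq_trans (size_sum _ _ _)); apply/bigmax_leqP => j _.
apply: (leq_trans (size_sum _ _ _)); apply/bigmax_leqP => l _.
apply: (leq_trans (size_polyMleq _ _)); apply: (leq_trans (leq_pred _)).
have szX1 : (size (('X + 1 : {poly F}) ^+ kap l) <= (kap l).+1)%N.
  by apply: (leq_trans (size_poly_exp_leq _ _)); rewrite size_XaddC mul1n.
have szX : (size ('X^(kap j) * ('X + 1 : {poly F}) ^+ kap l)%R <= kap j + (kap l).+1)%N.
  apply: (leq_trans (size_polyMleq _ _)); rewrite size_polyXn /=.
  by rewrite leq_add2l.
apply: (leq_trans (leq_add (szA j l) szX)).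
have := kap_le j; have := kap_le l.
have MNM : (M < N * M)%N by move: M_gt0 MN; nia.
move: MNM; move: (N * M)%N => NM; lia.
Qed.

End StepanovBound.

(** Two residues k i and k j closer than G, or one within G of q, give a relation by subtraction.
    Coprimality excludes equal residues, since q would divide j - i < N < q. *)
Lemma separated_or_short_relation (q N G k : nat) :
  coprime k q -> (0 < N < q)%N -> (0 < G < q)%N ->
  ((forall i j : 'I_N, i != j ->
     ((k * i) %% q + G <= (k * j) %% q)%N || ((k * j) %% q + G <= (k * i) %% q)%N) /\
   (forall i : 'I_N, ((k * i) %% q + G <= q)%N)) \/
  exists a b, [/\ (0 < a < N)%N, (0 < b < G)%N &
    (k * a = b %[mod q])%N \/ (q %| k * a + b)%N].
Proof.
move=> kq /andP [N0 Nq] /andP [G0 Gq].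
have q0 : (0 < q)%N by lia.
pose kap i := ((k * i) %% q)%N.
have kapB i j : (i <= j)%N -> (kap j + k * i = kap i + k * j %[mod q])%N.
  by move=> ij; rewrite /kap modnDml modnDml addnC.
case: (boolP [forall i : 'I_N, kap i + G <= q]%N) => [/forallP le|]; last first.
  case/forallPn => i; rewrite -ltnNge => lt; right.
  have lti : (kap i < q)%N by rewrite ltn_mod.
  exists i, (q - kap i)%N; split.
  - rewrite ltn_ord andbT lt0n; apply: contraTneq lt => i0.
    by rewrite /kap i0 muln0 mod0n; lia.
  - lia.
  - right; rewrite /dvdn -modnDml -/(kap i) subnKC ?modnn // ltnW //.
case: (boolP [forall i : 'I_N, [forall j : 'I_N, (i != j) ==>
    ((kap i + G <= kap j) || (kap j + G <= kap i))]]%N) => [/forallP sep|].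
  left; split=> // i j ij; exact: (implyP (forallP (sep i) j)).
case/forallPn => i0 /forallPn [j0]; rewrite negb_imply negb_or -!ltnNge.
case/and3P => ij0 lt1 lt2; right.
have [i [j [ij jN ltij ltji]]] : exists i j, [/\ (i < j)%N, (j < N)%N,
    (kap j < kap i + G)%N & (kap i < kap j + G)%N].
  have [ij|ji|e] := ltngtP i0 j0.
  - by exists i0, j0; split=> //.
  - by exists j0, i0; split=> //.
  - by move/negP: ij0; case; apply/eqP/val_inj.
have e := kapB _ _ (ltnW ij).
have ka : (k * j = k * i + k * (j - i))%N by rewrite -mulnDr subnKC // ltnW.
have e' : (kap j = kap i + k * (j - i) %[mod q])%N.
  by move/eqP: e; rewrite ka [(k * i + _)%N]addnC addnA eqn_modDr => /eqP.
exists (j - i)%N; case: (ltngtP (kap i) (kap j)) => [lt|lt|eq].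
- exists (kap j - kap i)%N; split; [lia|lia|left].
  apply/eqP; rewrite -(eqn_modDl (kap i)) subnKC ?(ltnW lt) //; exact/eqP.
- exists (kap i - kap j)%N; split; [lia|lia|right].
  move/eqP: e'; rewrite -{1}[kap j]addn0.
  have {1}-> : (kap i = kap j + (kap i - kap j))%N by rewrite subnKC // ltnW.
  by rewrite -addnA eqn_modDl mod0n eq_sym addnC.
- move/eqP: e'; rewrite -eq -{1}[kap i]addn0 eqn_modDl mod0n eq_sym.
  rewrite -/(dvdn _ _) Gauss_dvdr ?[coprime q k]coprime_sym // => /dvdn_leq.
  by rewrite subn_gt0 ij => /(_ isT); lia.
Qed.

(** * Roots of w^k + 1 = s (w + 1)^k when k satisfies a short relation *)

Lemma euler_binomial (F : fieldType) (c : F) (n m : nat) :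
  'X * ((c *: 'X^n + 1%:P) ^+ m)^`() * (c *: 'X^n + 1%:P) =
     (m * n)%:R%:P * (c *: 'X^n) * (c *: 'X^n + 1%:P) ^+ m :> {poly F}.
Proof.
rewrite deriv_exp derivD derivC addr0 derivZ derivXn.
case: n => [|n]; first by rewrite mulr0n scaler0 mul0r mul0rn mulr0 muln0 !mul0r.
case: m => [|m]; first by rewrite mulr0n mulr0 !mul0r.
rewrite /= -[_ *+ m.+1]mulr_natl -['X^n *+ n.+1]mulr_natl -!mul_polyC
  natrM polyCM !polyC_natr !(exprS _ n) (exprS _ m) /=; ring.
Qed.

(* Compares the logarithmic derivatives of (1 + u^k X^b)^a and its multiple
   (1 + u X^a)^b; here U = u X^a, V = u^k X^b and n = a b. *)
Lemma euler_binomial_cross (R : comNzRingType) (c n G H H' U V : R) :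
  H' * (V + 1) = n * V * (c * H) -> G * (U + 1) = n * U * H ->
  c * G = H' -> c * n * H * (U - V) = 0.
Proof.
move=> e1 e2 e3.
transitivity (c * (n * U * H) * (V + 1) - (n * V * (c * H)) * (U + 1)); first by ring.
by rewrite -e1 -e2 -e3; ring.
Qed.

Section RatioSet.

Variables (p k : nat).
Hypotheses (p_prime : prime p) (k_coprime : coprime k (p - 1)).
Local Notation F := 'F_p.

Lemma card_Fp_pred : #|F|.-1 = (p - 1)%N.
Proof. by rewrite card_Fp // subn1. Qed.

Lemma card_Fp_neq0 : #|[pred x : F | x != 0]| = (p - 1)%N.
Proof. by rewrite -card_Fp_pred -(cardC1 (0 : F)); apply: eq_card. Qed.

Lemma Fp_expr_pred (x : F) : x != 0 -> x ^+ (p - 1) = 1.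
Proof.
move=> x0; apply: (mulfI x0); rewrite mulr1 -exprS -card_Fp_pred.
by rewrite prednK ?expf_card // card_Fp // prime_gt0.
Qed.

Lemma Fp_expr_mod (x : F) a b : x != 0 -> (a = b %[mod p - 1])%N -> x ^+ a = x ^+ b.
Proof.
by move=> x0 ab; rewrite -(expr_mod _ (Fp_expr_pred x0)) ab expr_mod // Fp_expr_pred.
Qed.

Lemma coprime_pred_gt0 : (2 < p)%N -> (0 < k)%N.
Proof.
move=> p2; rewrite lt0n; apply: contraTneq k_coprime => ->.
by rewrite /coprime gcd0n; lia.
Qed.

Lemma Fp_expr_inj : (2 < p)%N -> injective (fun x : F => x ^+ k).
Proof.
move=> p2 x y /= xy; have k0 := coprime_pred_gt0 p2.
have [x0|x0] := eqVneq x 0.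
  by move/esym/eqP: xy; rewrite x0 expr0n (gtn_eqF k0) expf_eq0 k0 => /eqP.
have y0 : y != 0 by have := expf_neq0 k x0; rewrite xy expf_eq0 k0.
case: (egcdnP (p - 1) k0) => km kn e _.
move/eqP: k_coprime => kc; rewrite kc in e.
have inv (z : F) : z != 0 -> z ^+ k ^+ km = z.
  by move=> z0; rewrite -exprM mulnC e exprD [(kn * _)%N]mulnC exprM Fp_expr_pred // expr1n mul1r.
by rewrite -(inv x x0) xy inv.
Qed.

(** If x + y = e and x^k + y^k = s e^k with x, y, e nonzero, then w = x / y belongs to this set,
    which therefore counts the solutions of the two equations. *)
Definition ratio_set (s : F) : {set F} :=
  [set w | [&& w != 0, w + 1 != 0 & w ^+ k + 1 == s * (w + 1) ^+ k]]%SET.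

(* Averaging over the twists w = u y^a replaces coset representatives of a-th powers. *)
Lemma card_le_twisted_roots (Z : {set F}) (a D : nat) :
  (forall u : F, u != 0 -> (#|[pred y : F | (y != 0) && (u * y ^+ a \in Z)]%R| <= D)%N) ->
  (forall w : F, w \in Z -> w != 0) -> (#|Z| <= D)%N.
Proof.
move=> ZD Z0; rewrite -(@leq_pmul2l (p - 1)) ?subn_gt0 ?prime_gt1 //.
rewrite -card_Fp_neq0 -!sum_nat_const.
apply: (@leq_trans (\sum_(u : F | u != 0) #|[pred y : F | (y != 0) && (u * y ^+ a \in Z)]%R|)).
  under [leqRHS]eq_bigr => u _ do rewrite -sum1_card big_mkcondr /=.
  rewrite exchange_big /=; apply: leq_sum => y; rewrite inE => y0.
  rewrite -big_mkcondr sum1_card -(card_in_imset (f := fun w => w / y ^+ a)).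
    apply/subset_leq_card/subsetP => u /imsetP [w wZ ->].
    rewrite -topredE /= mulfVK ?expf_neq0 // wZ andbT.
    by rewrite mulf_neq0 ?invr_eq0 ?expf_neq0 //; apply: Z0.
  by move=> w w' _ _ /(mulIf _); apply; rewrite invr_eq0 expf_neq0.
by apply: leq_sum => u; apply: ZD.
Qed.

Lemma card_root_lt (P : pred F) (G : {poly F}) D : G != 0 -> (size G <= D.+1)%N ->
  (forall y, P y -> root G y) -> (#|P| <= D)%N.
Proof.
move=> G0 szG PG; rewrite -ltnS; apply: leq_trans szG.
rewrite cardE; apply: max_poly_roots => //; last exact: enum_uniq.
by apply/allP => y; rewrite mem_enum; apply: PG.
Qed.

Lemma pchar_Fp_nat_neq0 n : (0 < n < p)%N -> n%:R != 0 :> F.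
Proof. exact: (natr_neq0_lt (pchar_Fp p_prime)). Qed.

Lemma size_binomial (c d : F) (a b : nat) :
  (size ((c *: 'X^b + d%:P) ^+ a : {poly F}) <= (b * a).+1)%N.
Proof.
apply: (leq_trans (size_poly_exp_leq _ _)); rewrite ltnS leq_mul2r; apply/orP; right.
suff : (size (c *: 'X^b + d%:P : {poly F})%R <= b.+1)%N by case: (size _).
apply: (leq_trans (size_polyD _ _)); rewrite geq_max.
rewrite (leq_trans (size_scale_leq _ _)) ?size_polyXn //=.
by rewrite (leq_trans (size_polyC_leq1 _)).
Qed.

(** With w = u y^a and y^(k a) = y^b, the a-th power of the equation reads (u^k y^b + 1)^a = s^a (u
    y^a + 1)^b, of degree at most a b in y. *)
Lemma ratio_set_pos (s : F) (a b : nat) :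
  (0 < a < p)%N -> (0 < b < p)%N -> a != b -> (k * a = b %[mod p - 1])%N ->
  s != 0 -> (#|ratio_set s| <= a * b)%N.
Proof.
move=> /andP [a0 ap] /andP [b0 bp] ab kab s0.
apply: (@card_le_twisted_roots _ a) => [u u0|w]; last by rewrite inE => /andP [].
pose G : {poly F} := (u ^+ k *: 'X^b + 1%:P) ^+ a.
pose H : {poly F} := (u *: 'X^a + 1%:P) ^+ b.
apply: (@card_root_lt _ (G - s ^+ a *: H)).
(* Were the two sides equal as polynomials, their logarithmic derivatives would give u X^a = u^k
   X^b, against a <> b; here a b is invertible because both are below p. *)
- rewrite subr_eq0; apply/negP => /eqP GH.
  have := euler_binomial (u ^+ k) b a; rewrite -/G GH derivZ => e1.
  have := euler_binomial u a b; rewrite -/H => e2.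
  have H0 : H != 0.
    apply/negP => /eqP H0; move/eqP: (congr1 (fun P : {poly F} => P.[0]) H0).
    rewrite horner_exp hornerD hornerZ hornerXn hornerC horner0 expr0n.
    by rewrite (gtn_eqF a0) mulr0 add0r expr1n oner_eq0.
  have : (s ^+ a)%:P * (a * b)%:R%:P * H * (u *: 'X^a - u ^+ k *: 'X^b) = 0.
    apply: (euler_binomial_cross (G := 'X * H^`()) (H' := 'X * (s ^+ a *: H^`()))).
    - by rewrite [_%:P * H]mul_polyC -e1 polyC1.
    - by rewrite [(a * b)%N]mulnC -e2 polyC1.
    - by rewrite -!mul_polyC mulrCA.
  apply/eqP; apply: mulf_neq0; first (apply: mulf_neq0 => //; apply: mulf_neq0).
  - by rewrite polyC_eq0 expf_neq0.
  - by rewrite polyC_eq0 natrM mulf_neq0 // pchar_Fp_nat_neq0 ?a0 ?b0.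
  apply/negP => /eqP /(congr1 (fun P : {poly F} => P`_a)).
  rewrite /= coefB !coefZ !coefXn eqxx (negPf ab) coef0 mulr1 mulr0 subr0 => /eqP.
  by rewrite (negPf u0).
- apply: (leq_trans (size_polyD _ _)); rewrite size_polyN geq_max.
  have -> : (a * b)%N = (b * a)%N by rewrite mulnC.
  apply/andP; split; first exact: size_binomial.
  apply: (leq_trans (size_scale_leq _ _)); rewrite mulnC; exact: size_binomial.
- move=> y /andP [y0]; rewrite inE => /and3P [_ w1 /eqP wk].
  rewrite /root hornerD hornerN hornerZ !horner_exp !hornerD !hornerZ !hornerXn !hornerC.
  have -> : y ^+ b = y ^+ a ^+ k by rewrite -exprM mulnC; apply: Fp_expr_mod.
  by rewrite -exprMn wk exprMn -exprM (Fp_expr_mod w1 kab) subrr.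
Qed.

(** Now y^(k a) is the inverse of y^b; clearing denominators gives a polynomial of degree at most 2
    a b with the nonzero value u^(k a) at 0. *)
Lemma ratio_set_neg (s : F) (a b : nat) :
  (0 < a)%N -> (0 < b)%N -> (p - 1 %| k * a + b)%N ->
  (#|ratio_set s| <= 2 * a * b)%N.
Proof.
move=> a0 b0 kab.
apply: (@card_le_twisted_roots _ a) => [u u0|w]; last by rewrite inE => /andP [].
pose G : {poly F} := (1 *: 'X^b + (u ^+ k)%:P) ^+ a * (u *: 'X^a + 1%:P) ^+ b.
have one (y : F) : y != 0 -> y ^+ (k * a) * y ^+ b = 1.
  by move=> y0; rewrite -exprD; case/dvdnP: kab => c ->;
     rewrite [(c * _)%N]mulnC exprM Fp_expr_pred // expr1n.
apply: (@card_root_lt _ (G - s ^+ a *: 'X^(a * b))).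
- apply/negP => /eqP /(congr1 (fun P : {poly F} => P.[0])).
  rewrite /= hornerD hornerN hornerM !horner_exp !hornerD !hornerZ !hornerXn !hornerC.
  rewrite !expr0n muln_eq0 (gtn_eqF a0) (gtn_eqF b0) !mulr0 subr0 !add0r expr1n mulr1.
  by apply/eqP; rewrite !expf_neq0.
- apply: (leq_trans (size_polyD _ _)); rewrite size_polyN geq_max; apply/andP; split.
    apply: (leq_trans (size_polyMleq _ _)).
    apply: (@leq_trans ((b * a).+1 + (a * b).+1).-1); last by lia.
    by rewrite -!subn1 leq_sub2r // leq_add ?size_binomial.
  by rewrite (leq_trans (size_scale_leq _ _)) // size_polyXn; lia.
- move=> y /andP [y0]; rewrite inE => /and3P [_ w1 /eqP wk].
  rewrite /root hornerD hornerN hornerM hornerZ !horner_exp !hornerD !hornerZ !hornerXn.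
  rewrite !hornerC mul1r.
  have := one _ w1; rewrite exprM => onew.
  rewrite subr_eq0; apply/eqP.
  transitivity (((u * y ^+ a) ^+ k + 1) ^+ a * y ^+ (a * b) * (u * y ^+ a + 1) ^+ b).
    congr (_ * _); rewrite mulnC exprM -exprMn; congr (_ ^+ a).
    by rewrite mulrDl mul1r exprMn -exprM [(a * k)%N]mulnC -mulrA one // mulr1 addrC.
  by rewrite wk exprMn [s ^+ a * _ * y ^+ _]mulrAC -[LHS]mulrA onew mulr1 hornerX.
Qed.

End RatioSet.

(** * The fourth moment of the character sums of (x, c x^k) *)

Section FourthMoment.

Variables (p k : nat).
Hypotheses (p_prime : prime p) (p_gt2 : (2 < p)%N) (k_coprime : coprime k (p - 1)).
Local Notation F := 'F_p.

(** The parameters N = 5 M and G = N M suit Stepanov's method; a relation with a <> b leaves at most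
    2 a b <= 50 M^3 roots, so only k a = a escapes. *)
Lemma ratio_set_bound (M : nat) : (0 < M)%N -> (5 * M < p - 1)%N ->
  (5 * M * M < p - 1)%N ->
  (exists2 a, (0 < a < 5 * M)%N & (k * a = a %[mod p - 1])%N) \/
  forall s : F, s != 0 ->
    (#|ratio_set k s| * M <= 2 * p)%N \/ (#|ratio_set k s| <= 50 * M ^ 3)%N.
Proof.
move=> M0 Np Gp.
have [||[sep le]|[a [b [aN bG [kab|kab]]]]] :=
    @separated_or_short_relation (p - 1) (5 * M) (5 * M * M) k k_coprime; try lia.
- right=> s s0; left.
  apply: (@stepanov_bound 'F_p p M (5 * M) (fun j => (k * j) %% (p - 1))%N
     (pchar_Fp p_prime) M0 _ _ _ (ratio_set k s) (fun z => z ^+ k) s^-1).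
  + lia.
  + exact: sep.
  + move=> i; apply: leq_trans (le i) _; lia.
  + lia.
  + by move=> z; rewrite inE => /and3P [-> ->].
  + move=> z j; rewrite inE => /and3P [z0 _ _]; rewrite -exprM.
    by apply: Fp_expr_mod => //; rewrite modn_mod.
  + move=> z l; rewrite inE => /and3P [_ z1 /eqP ->]; rewrite mulKf // -exprM.
    by apply: Fp_expr_mod => //; rewrite modn_mod.
- have [ab|ab] := eqVneq a b; first by left; exists a => //; rewrite {2}ab.
  right=> s s0; right; apply: (leq_trans (ratio_set_pos p_prime _ _ ab kab s0)); try lia.
  case/andP: aN => _ aN; case/andP: bG => _ bG.
  apply: (leq_trans (leq_mul (ltnW aN) (ltnW bG))); nia.
- right=> s s0; right; apply: (leq_trans (ratio_set_neg p_prime k_coprime s _ _ kab)); try lia.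
  case/andP: aN => _ aN; case/andP: bG => _ bG.
  rewrite -mulnA; apply: (leq_trans (leq_mul (leqnn 2) (leq_mul (ltnW aN) (ltnW bG)))); nia.
Qed.

Lemma coprime_pred_odd : odd p -> odd k.
Proof.
move=> po; have : coprime k 2.
  by apply: coprime_dvdr k_coprime; rewrite dvdn2 oddB ?po // ltnW // ltnW.
by rewrite coprimen2.
Qed.

Definition pair_row (a b : F) : 'rV[F]_2 := \row_(j < 2) (if j == 0 then a else b).

Lemma pair_rowP a b (v : 'rV[F]_2) : (pair_row a b == v) = (a == v 0 0) && (b == v 0 1).
Proof.
apply/eqP/andP => [<-|[/eqP -> /eqP ->]]; first by rewrite !mxE.
by apply/rowP => j; rewrite mxE; case: j => -[|[|//]] ?; congr (v _ _); apply: val_inj.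
Qed.

Lemma dot_pair_row u a b : dot u (pair_row a b) = u 0 0 * a + u 0 1 * b.
Proof.
rewrite /dot mxE big_ord_recl big_ord1 !mxE /=.
by congr (_ + u 0 _ * _); apply: val_inj.
Qed.

Hypothesis p_odd : odd p.

Lemma Fp_expr_opp (x : F) : (- x) ^+ k = - x ^+ k.
Proof. by rewrite exprNn -signr_odd coprime_pred_odd // mulN1r. Qed.

Variables (c : F) (r : nat).
Hypotheses (c_neq0 : c != 0).
Hypothesis ratio_le : forall s : F, s != 0 -> (#|ratio_set k s| <= r)%N.

Definition nonzero_pair (x : F * F) := (x.1 != 0) && (x.2 != 0).
Definition pair_moment (x : F * F) := pair_row (x.1 + x.2) (c * x.1 ^+ k + c * x.2 ^+ k).

Lemma card_pair_moment_zero (x : F * F) : x.1 + x.2 = 0 ->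
  (#|[pred x' | nonzero_pair x' & pair_moment x == pair_moment x']| <= p - 1)%N.
Proof.
move=> x0; rewrite -(card_Fp_neq0 p_prime) -(@card_in_imset _ _ (fun x' => x'.1)).
  apply/subset_leq_card/subsetP => y /imsetP [[y1 y2]]; rewrite !inE.
  by case/andP => /andP [] /= y10 _ _ ->.
move=> [y1 y2] [z1 z2]; rewrite !inE !pair_rowP !mxE /= x0.
case/and3P => _ /eqP/esym/eqP; rewrite addr_eq0 => /eqP -> _.
case/and3P => _ /eqP/esym/eqP; rewrite addr_eq0 => /eqP -> _.
by move=> /oppr_inj ->.
Qed.

(** With e the common sum, the ratio y1 / y2 lies in a [ratio_set] and determines the pair, since y2
    = e / (y1 / y2 + 1). *)
Lemma card_pair_moment_neq0 (x : F * F) : nonzero_pair x -> x.1 + x.2 != 0 ->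
  (#|[pred x' | nonzero_pair x' & pair_moment x == pair_moment x']| <= r)%N.
Proof.
case: x => x1 x2 /andP [] /= x10 x20 x0.
set e := x1 + x2 in x0; pose s := (x1 ^+ k + x2 ^+ k) / e ^+ k.
(* This holds because x -> x^k is odd and injective. *)
have s0 : s != 0.
  rewrite mulf_neq0 ?invr_eq0 ?expf_neq0 // addr_eq0 -Fp_expr_opp.
  by apply: contra x0 => /eqP /(Fp_expr_inj p_prime k_coprime p_gt2) x1E; rewrite /e x1E addNr.
apply: leq_trans (ratio_le s0); rewrite -(@card_in_imset _ _ (fun y => y.1 / y.2)).
  apply/subset_leq_card/subsetP => w /imsetP [[y1 y2]]; rewrite !inE.
  case/andP => /andP [] /= y10 y20; rewrite pair_rowP !mxE /= -/e => /andP [/eqP ey /eqP yk] ->.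
  have wE : y1 / y2 + 1 = e / y2 by rewrite ey mulrDl divff.
  rewrite wE !mulf_neq0 ?invr_eq0 //=.
  move: yk; rewrite -!mulrDr => /(mulfI c_neq0) yk.
  by rewrite /s yk !expr_div_n mulrA mulfVK ?expf_neq0 // mulrDl divff ?expf_neq0.
move=> [y1 y2] [z1 z2]; rewrite !inE !pair_rowP !mxE /= -/e.
case/and3P => /andP [] /= y10 y20 /eqP ey _; case/and3P => /andP [] /= z10 z20 /eqP ez _ yz.
have sndE (a b : F) : b != 0 -> e = a + b -> b = e / (a / b + 1).
  move=> b0 eab; rewrite eab -[X in _ / (_ + X)](divff b0) -mulrDl invf_div mulrCA.
  by rewrite divff ?mulr1 // -eab.
have y2z2 : y2 = z2 by rewrite (sndE _ _ y20 ey) (sndE _ _ z20 ez) yz.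
by rewrite -(divfK y20 y1) yz y2z2 divfK.
Qed.

Lemma card_nonzero_pair : #|[pred x | nonzero_pair x]| = ((p - 1) * (p - 1))%N.
Proof.
rewrite -(card_Fp_neq0 p_prime) -cardX; apply: eq_card => -[x y].
by rewrite !inE.
Qed.

(** Each of the p - 1 pairs of sum 0 collides with at most p - 1 pairs, which accounts for the 1 in
    r + 1; any other pair collides with at most r. *)
Lemma card_collision_le :
  (#|[pred xx : (F * F) * (F * F) | [&& nonzero_pair xx.1, nonzero_pair xx.2 &
      pair_moment xx.1 == pair_moment xx.2]]| <= (p - 1) ^ 2 * r.+1)%N.
Proof.
rewrite -sum1_card (eq_bigl (fun xx : (F * F) * (F * F) => nonzero_pair xx.1 &&
   (nonzero_pair xx.2 && (pair_moment xx.1 == pair_moment xx.2)))) //.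
rewrite -(pair_big_dep nonzero_pair (fun x x' => nonzero_pair x' &&
   (pair_moment x == pair_moment x')) (fun _ _ => 1%N)) /=.
apply: (@leq_trans (\sum_(x | nonzero_pair x) ((x.1 + x.2 == 0)%R * (p - 1) + r))).
  apply: leq_sum => x nzx; rewrite sum1_card.
  rewrite (eq_card (B := [pred x' | nonzero_pair x' & pair_moment x == pair_moment x'])) //.
  case: eqVneq => [x0|x0]; last by rewrite mul0n add0n; apply: (card_pair_moment_neq0 nzx x0).
  by rewrite mul1n (leq_trans (card_pair_moment_zero x0)) // leq_addr.
rewrite big_split /= sum_nat_const mulnS leq_add //; last first.
  by rewrite card_nonzero_pair mulnn.
rewrite -big_distrl /= -mulnn leq_mul2r; apply/orP; right.
rewrite -big_mkcondr sum1_card -(card_Fp_neq0 p_prime) -(@card_in_imset _ _ (fun x' => x'.1)).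
  apply/subset_leq_card/subsetP => y /imsetP [[y1 y2]].
  by rewrite -topredE !inE /= => /andP [] /andP [] /= y10 _ _ ->.
move=> [y1 y2] [z1 z2]; rewrite -!topredE /= !addr_eq0.
by case/andP => _ /eqP -> /andP [_ /eqP ->] /oppr_inj ->.
Qed.

Variable zeta : algC.
Hypothesis zeta_prim : p.-primitive_root zeta.

Definition monomial_sum (u : 'rV[F]_2) : algC :=
  char_sum zeta [pred x : F | x != 0] (fun x => pair_row x (c * x ^+ k)) u.

Lemma monomial_sum_sqr u :
  char_sum zeta nonzero_pair pair_moment u = monomial_sum u ^+ 2.
Proof.
rewrite expr2 /monomial_sum /char_sum big_distrlr /= pair_big /=.
apply: eq_bigr => -[x y] _ /=; rewrite -add_charD //; congr (add_char _ _).
rewrite -dotDr; congr (dot u _); apply/eqP; rewrite pair_rowP !mxE /=.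
by rewrite !eqxx.
Qed.

(** Substituting t x for x, the sum takes the same value at the p - 1 frequencies (u_1 t, u_2 t^k);
    Parseval for its square bounds their total by the number of collisions. *)
Lemma monomial_sum_bound u : u != 0 ->
  (p - 1)%:R * `|monomial_sum u| ^+ 4 <= (p ^ 2 * ((p - 1) ^ 2 * r.+1))%:R.
Proof.
move=> u0; pose g (t : F) := pair_row (u 0 0 * t) (u 0 1 * t ^+ k).
have S_g t : t != 0 -> monomial_sum (g t) = monomial_sum u.
  move=> t0; rewrite /monomial_sum /char_sum [RHS](reindex_inj (mulfI t0)) /=.
  apply: eq_big => [x|x _]; first by rewrite mulf_eq0 (negPf t0).
  congr (add_char _ _); rewrite !dot_pair_row !mxE /= exprMn.
  by rewrite mulrA; congr (_ + _); rewrite -!mulrA; congr (_ * _); rewrite mulrCA.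
have := @char_sum_orbit p 2 zeta p_prime zeta_prim _ _ nonzero_pair pair_moment
   [pred t : F | t != 0] g u.
rewrite card_Fp_neq0 // monomial_sum_sqr normrX -exprM => h.
apply: (le_trans (h _ _)) => [t t' t0 t0' /eqP|t t0|].
- rewrite pair_rowP !mxE /= => /andP [/eqP e1 /eqP e2].
  have [u00|u00] := eqVneq (u 0 0) 0; last by apply: (mulfI u00).
  have u01 : u 0 1 != 0.
    apply: contraNneq u0 => u01; rewrite eq_sym -(_ : pair_row 0 0 = 0).
      by rewrite pair_rowP u00 u01 !eqxx.
    by apply/rowP => j; rewrite !mxE; case: ifP.
  by apply: (Fp_expr_inj p_prime k_coprime p_gt2); apply: (mulfI u01).
- by rewrite monomial_sum_sqr S_g.
- by rewrite ler_nat card_mx mul1n card_Fp // leq_mul2l card_collision_le orbT.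
Qed.

(** Two copies of the L by L box of step n serve as D and E in [large_char_sum]. Without a solution
    some |S u| would be at least (p - 1) L^2 / p^2, too large for the fourth moment. *)
Lemma hit_of_ratio_bound (i j n L : nat) :
  (0 < n < p)%N -> (0 < L)%N -> (n * L < p)%N ->
  (p ^ 10 * r.+1 < (p - 1) ^ 3 * L ^ 8)%N ->
  exists x t s, [/\ (t.+1 < 2 * L)%N, (s.+1 < 2 * L)%N, x != 0 :> F,
    x = (i + n * t)%:R & c * x ^+ k = (j + n * s)%:R].
Proof.
move=> n0p L0 nL big.
pose f (x : F) := pair_row x (c * x ^+ k).
pose d (ts : 'I_L * 'I_L) := pair_row (n * ts.1)%:R (n * ts.2)%:R.
case: (pickP (fun xab : F * ('I_L * 'I_L) * ('I_L * 'I_L) =>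
   (xab.1.1 != 0) && (f xab.1.1 == pair_row i%:R j%:R + d xab.1.2 + d xab.2))).
  move=> [[x [a1 a2]] [b1 b2]] /= /andP [x0].
  rewrite pair_rowP !mxE /= -!natrD => /andP [/eqP xE /eqP yE].
  exists x, (a1 + b1)%N, (a2 + b2)%N; split; rewrite ?x0 //.
  - by have := ltn_ord a1; have := ltn_ord b1; lia.
  - by have := ltn_ord a2; have := ltn_ord b2; lia.
  - by rewrite mulnDr addnA.
  - by rewrite mulnDr addnA.
move=> nohit; exfalso.
have d_inj : {in [pred ts : 'I_L * 'I_L | true] &, injective d}.
  have inj (a b : 'I_L) : (n * a)%:R = (n * b)%:R :> F -> a = b.
    have lt (m : 'I_L) : (n * m < p)%N.
      by apply: leq_ltn_trans nL; rewrite leq_mul2l ltnW ?orbT.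
    move=> /(natr_inj_lt (pchar_Fp p_prime) (lt a) (lt b)) /eqP.
    by rewrite eqn_pmul2l ?(proj1 (andP n0p)) // => /eqP /val_inj.
  move=> [a1 a2] [b1 b2] _ _ /eqP; rewrite pair_rowP !mxE /= => /andP [/eqP e1 /eqP e2].
  by rewrite (inj _ _ e1) (inj _ _ e2).
have [|||||u u0] := @large_char_sum p 2 zeta p_prime zeta_prim F [pred x | x != 0] f
   _ [pred ts : 'I_L * 'I_L | true] d d (pair_row i%:R j%:R).
- by rewrite card_Fp_neq0 // subn_gt0 ltnW.
- by apply/card_gt0P; exists (Ordinal L0, Ordinal L0).
- exact: d_inj.
- exact: d_inj.
- move=> x a b /= x0 _ _; have := nohit (x, a, b); rewrite /= x0 /= => ->.
  by [].
rewrite card_Fp_neq0 // card_mx mul1n card_Fp //.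
have -> : #|[pred ts : 'I_L * 'I_L | true]| = (L * L)%N.
  by rewrite -[RHS](congr2 muln (card_ord L) (card_ord L)) -card_prod; apply: eq_card.
rewrite -/(monomial_sum u) => big1.
have big2 := monomial_sum_bound u0.
have : ((p - 1) * (L * L))%:R ^+ 4 * (p - 1)%:R <=
    (p ^ 2)%:R ^+ 4 * (p ^ 2 * ((p - 1) ^ 2 * r.+1))%:R :> algC.
  apply: (@le_trans _ _ (((p ^ 2)%:R * `|monomial_sum u|) ^+ 4 * (p - 1)%:R)).
    by rewrite ler_wpM2r ?ler0n // lerXn2r ?nnegrE ?mulr_ge0 ?ler0n.
  by rewrite exprMn -mulrA [_ ^+ 4 * (p - 1)%:R]mulrC ler_wpM2l ?exprn_ge0 ?ler0n.
rewrite -!natrX -!natrM ler_nat leqNgt => /negP; apply.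
have q0 : (0 < (p - 1) ^ 2)%N by rewrite expn_gt0 subn_gt0 ltnW.
have -> : ((p ^ 2) ^ 4 * (p ^ 2 * ((p - 1) ^ 2 * r.+1)) = (p - 1) ^ 2 * (p ^ 10 * r.+1))%N.
  by rewrite !expnS expn0; ring.
have -> : (((p - 1) * (L * L)) ^ 4 * (p - 1) = (p - 1) ^ 2 * ((p - 1) ^ 3 * L ^ 8))%N.
  by rewrite !expnS expn0; ring.
by rewrite ltn_pmul2l.
Qed.

End FourthMoment.

(** * Fibers of x -> x^e and their character sums *)

Section PowerFibers.

Variables (p e : nat) (zeta : algC).
Hypotheses (p_prime : prime p) (zeta_prim : p.-primitive_root zeta).
Local Notation F := 'F_p.

Definition power_fiber (d : F) : pred F := [pred x : F | (x != 0) && (x ^+ e == d)].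

Lemma mem_power_fiber (d x : F) : (x \in power_fiber d) = (x != 0) && (x ^+ e == d).
Proof. by []. Qed.

Lemma power_fiber_mulr (d h x : F) : power_fiber 1 h ->
  power_fiber d (h * x) = power_fiber d x.
Proof.
by case/andP => h0 /eqP he; rewrite /power_fiber /= mulf_eq0 (negPf h0) exprMn he mul1r.
Qed.

Lemma card_power_fiber_le (d : F) : (#|power_fiber d| <= #|power_fiber 1%R|)%N.
Proof.
case: (pickP (power_fiber d)) => [x0 /andP [x00 /eqP x0d]|none]; last by rewrite eq_card0.
have d0 : d != 0 by rewrite -x0d expf_neq0.
rewrite -(@card_in_imset _ _ (fun x => x / x0)); last first.
  by move=> x y _ _ /(mulIf _); apply; rewrite invr_eq0.
apply/subset_leq_card/subsetP => y /imsetP [x]; rewrite mem_power_fiber.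
case/andP => xn0 /eqP xd ->; rewrite mem_power_fiber mulf_neq0 ?invr_eq0 //=.
by rewrite expr_div_n xd x0d divff.
Qed.

Lemma card_power_fiber_ge (d x0 : F) : power_fiber d x0 ->
  (#|power_fiber 1%R| <= #|power_fiber d|)%N.
Proof.
move=> dx0; have x00 : x0 != 0 by case/andP: dx0.
rewrite -(@card_in_imset _ _ (fun x => x * x0)); last by move=> x y _ _ /(mulIf x00).
apply/subset_leq_card/subsetP => y /imsetP [x Hx ->].
by rewrite -topredE /= power_fiber_mulr.
Qed.

(** The values of x^e are a-th roots of unity, at most a in number, and no fiber is larger than the
    kernel. *)
Lemma card_power_kernel (a : nat) : (0 < a)%N -> (p - 1 %| e * a)%N ->
  (p - 1 <= a * #|power_fiber 1%R|)%N.
Proof.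
move=> a0 /dvdnP [q qE]; rewrite -(card_Fp_neq0 p_prime) -sum1_card.
rewrite (partition_big (fun x : F => x ^+ e) (fun d => d ^+ a == 1)) /=; last first.
  by move=> x x0; rewrite -exprM qE mulnC exprM Fp_expr_pred // expr1n.
apply: (@leq_trans (\sum_(d : F | (d ^+ a == 1)%R) #|power_fiber 1%R|)).
  apply: leq_sum => d _; rewrite sum1_card; exact: card_power_fiber_le.
rewrite sum_nat_const leq_mul2r; apply/orP; right.
apply: (@card_root_lt _ _ ('X^a - 1)); first by rewrite -size_poly_eq0 size_XnsubC.
  by rewrite size_XnsubC.
move=> y /= ya; have {}ya : y ^+ a = 1 by apply/eqP.
by rewrite /root !hornerE ya subrr.
Qed.

Definition entry_row (x : F) : 'rV[F]_1 := const_mx x.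

Lemma entry_row_inj : injective entry_row.
Proof. by move=> x y /matrixP /(_ 0 0); rewrite !mxE. Qed.

(** The sum S u is unchanged when u is multiplied by an element of the kernel H, so Parseval bounds
    |H| |S u|^2 by p times the size of the fiber, at most p |H|. *)
Lemma power_fiber_sum_bound (d : F) (u : 'rV[F]_1) : u != 0 ->
  `|char_sum zeta (power_fiber d) entry_row u| ^+ 2 <= p%:R.
Proof.
move=> u0; pose g (h : F) := h *: u.
have H1 : power_fiber 1 1 by apply/andP; split; [exact: oner_neq0 | rewrite expr1n].
have H0 : (0 < #|power_fiber 1%R|)%N by apply/card_gt0P; exists 1.
have := @char_sum_orbit p 1 zeta p_prime zeta_prim _ _ (power_fiber d) entry_row
   (power_fiber 1%R) g u.
rewrite card_collision_inj; last by move=> x y _ _; apply: entry_row_inj.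
rewrite card_mx mul1n card_Fp // expn1 => h.
rewrite -(ler_pM2l (_ : 0 < #|power_fiber 1%R|%:R :> algC)) ?ltr0n //.
apply: (le_trans (h _ _)).
- move=> x y _ _ /eqP; rewrite -subr_eq0 -scalerBl scaler_eq0 (negPf u0) orbF subr_eq0.
  by move/eqP.
- move=> x Hx; have x0 : x != 0 by case/andP: Hx.
  rewrite /char_sum [RHS](reindex_inj (mulfI x0)) /=.
  apply: eq_big => [y|y _]; first by rewrite power_fiber_mulr.
  congr (add_char _ _); rewrite /dot !mxE !big_ord1 !mxE.
  by rewrite mulrAC mulrC mulrA.
- by rewrite -natrM ler_nat mulnC leq_mul2r card_power_fiber_le orbT.
Qed.

(** This is [large_char_sum] with D = n P and E = - n P: without a hit, the size of the fiber times
    |P| would be at most p |S u| <= p^(3/2). *)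
Lemma hit_of_power_fiber (d : F) (z : F) (n K : nat) (P : pred 'I_K) :
  (exists x, power_fiber d x) ->
  (0 < n < p)%N -> (n * K < p)%N ->
  (p ^ 3 < (#|power_fiber d| * #|P|) ^ 2)%N ->
  exists x t1 t2, [/\ power_fiber d x, P t1, P t2 & x = z + (n * t1)%:R - (n * t2)%:R].
Proof.
move=> [x0 dx0] n0p nK big.
case: (pickP (fun xt : F * 'I_K * 'I_K => [&& power_fiber d xt.1.1, P xt.1.2, P xt.2 &
   entry_row xt.1.1 == entry_row z + entry_row (n * xt.1.2)%:R + entry_row (- (n * xt.2)%:R)])).
  move=> [[x t1] t2] /= /and4P [dx P1 P2 /eqP xE]; exists x, t1, t2; split=> //.
  by move/matrixP: xE => /(_ 0 0); rewrite !mxE.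
move=> nohit; exfalso.
have inj (t t' : 'I_K) : (n * t)%:R = (n * t')%:R :> F -> t = t'.
  have lt (m : 'I_K) : (n * m < p)%N.
    by apply: leq_ltn_trans nK; rewrite leq_mul2l ltnW ?orbT.
  move=> /(natr_inj_lt (pchar_Fp p_prime) (lt t) (lt t')) /eqP.
  by rewrite eqn_pmul2l ?(proj1 (andP n0p)) // => /eqP /val_inj.
have := @large_char_sum p 1 zeta p_prime zeta_prim F (power_fiber d) entry_row
   _ P (fun t => entry_row (n * t)%:R) (fun t => entry_row (- (n * t)%:R)) (entry_row z).
case=> [||t t' _ _ /entry_row_inj|t t' _ _ /entry_row_inj /oppr_inj|x a b dx Pa Pb|u u0].
- by apply/card_gt0P; exists x0.
- rewrite lt0n; apply: contraTneq big => ->; by rewrite muln0 exp0n.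
- exact: inj.
- exact: inj.
- by have := nohit (x, a, b); rewrite /= dx Pa Pb /= => ->.
rewrite card_mx mul1n card_Fp // expn1 => big1.
have := power_fiber_sum_bound d u0 => big2.
have : (#|power_fiber d| * #|P|)%:R ^+ 2 <= p%:R ^+ 2 * p%:R :> algC.
  apply: (@le_trans _ _ ((p%:R * `|char_sum zeta (power_fiber d) entry_row u|) ^+ 2)).
    by rewrite lerXn2r ?nnegrE ?mulr_ge0 ?ler0n.
  by rewrite exprMn ler_wpM2l ?exprn_ge0 ?ler0n.
by rewrite -exprSr -!natrX ler_nat leqNgt big.
Qed.

(** Reducing 2 e modulo p - 1 gives 0 < m < p - 1, and X^m - 1 has too few roots to vanish at every
    nonzero x. *)
Lemma exists_power_sqr_neq1 : ~~ (p - 1 %| e * 2)%N ->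
  exists2 x : F, x != 0 & (x ^+ e) ^+ 2 != 1.
Proof.
move=> ndvd; pose m := (e * 2 %% (p - 1))%N.
have m0 : (0 < m)%N by rewrite lt0n.
case: (pickP (fun x : F => (x != 0) && (x ^+ e ^+ 2 != 1))) => [x /andP [x0 x1]|none].
  by exists x.
have := @card_root_lt p [pred x : F | x != 0] ('X^m - 1) m.
rewrite -size_poly_eq0 size_XnsubC // => /(_ isT (leqnn _)).
rewrite card_Fp_neq0 // leqNgt ltn_mod subn_gt0 prime_gt1 // => h.
exfalso; have /h// : forall y : F, [pred x | x != 0] y -> root ('X^m - 1) y.
move=> y /= y0; have := none y; rewrite y0 /= => /negbFE /eqP ye.
rewrite /root !hornerE subr_eq0 -ye -exprM.
by rewrite (Fp_expr_mod p_prime y0 (modn_mod _ _)).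
Qed.

End PowerFibers.

(** * Residues as quotients of small integers *)

Section Heights.

Variable p : nat.
Hypothesis p_prime : prime p.
Local Notation F := 'F_p.

Lemma Fp_intr_eq (x y : int) : (`|x - y| < p)%N -> x%:~R = y%:~R :> F -> x = y.
Proof.
move=> lt e; apply/eqP; rewrite -subr_eq0 -absz_eq0.
have : (`|x - y|%N)%:R = 0 :> F.
  have : (x - y)%:~R = 0 :> F by rewrite intrB e subrr.
  by case: (intP (x - y)) => [//|m|m]; rewrite ?abszN ?absz_nat ?intrN //= => /eqP;
    rewrite ?oppr_eq0 => /eqP.
move/eqP; rewrite -(dvdn_pcharf (pchar_Fp p_prime)) => /dvdn_leq h.
by move: h lt; case: (`|x - y|%N) => // m /(_ isT) le; rewrite ltnNge le.
Qed.

Variables Q T : nat.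

Definition small_height (B : F) :=
  [exists q : 'I_Q, [exists r : 'I_(2 * T).+1,
     (q.+1)%:R * B == (r%:Z - T%:Z)%:~R]].

Lemma small_heightP (B : F) :
  reflect (exists q r, [/\ (0 < q <= Q)%N, (`|r| <= T)%N & q%:R * B = r%:~R])
    (small_height B).
Proof.
apply: (iffP existsP) => [[q /existsP [r /eqP e]]|[q [r [/andP [q0 qQ] rT e]]]].
  exists q.+1, (r%:Z - T%:Z); split=> //; first exact: ltn_ord.
  by have := ltn_ord r; lia.
have q'Q : (q.-1 < Q)%N by rewrite prednK.
have r'T : (`|(r + T%:Z)%R| < (2 * T).+1)%N by lia.
exists (Ordinal q'Q); apply/existsP; exists (Ordinal r'T); apply/eqP => /=.
rewrite prednK // e; congr (_%:~R); lia.
Qed.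

Hypotheses (Q_gt0 : (0 < Q)%N) (T_gt0 : (0 < T)%N).
Hypothesis QT_lt : (2 * (T ^ 2 * Q ^ 2) < p)%N.

(* Small heights would force the r/q to form a geometric progression of rationals. *)
Lemma exists_large_height (A g : F) (a : nat) : (0 < a)%N -> A != 0 ->
  g ^+ a = 1 -> g ^+ 2 != 1 -> exists m, ~~ small_height (A * g ^+ m).
Proof.
move=> a0 A0 ga g2.
case: (pickP (fun m : 'I_a => ~~ small_height (A * g ^+ m))) => [m|small]; first by exists m.
exfalso.
have rep m : exists q r, [/\ (0 < q <= Q)%N, (`|r| <= T)%N & q%:R * (A * g ^+ m) = r%:~R].
  apply/small_heightP; rewrite -(expr_mod _ ga).
  have lt : (m %% a < a)%N by rewrite ltn_mod.
  by have := small (Ordinal lt) => /= /negbFE.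
have g0 : g != 0 by apply: contra_eq_neq ga => ->; rewrite expr0n gtn_eqF // eq_sym oner_neq0.
have Qp : (Q < p)%N.
  apply: leq_ltn_trans QT_lt; rewrite -[leqLHS]mul1n leq_mul // -[leqLHS]mul1n.
  by rewrite leq_mul ?expn_gt0 ?T_gt0 // leq_pmulr.
have r_neq0 m q r : (0 < q <= Q)%N -> q%:R * (A * g ^+ m) = r%:~R -> r != 0.
  move=> /andP [q0 qQ]; apply: contra_eqN => /eqP ->.
  rewrite mulf_neq0 ?mulf_neq0 ?expf_neq0 //.
  by apply: (natr_neq0_lt (pchar_Fp p_prime)); rewrite q0 (leq_ltn_trans qQ).
have [q0 [r0 [q0Q r0T e0]]] := rep 0%N; have [q1 [r1 [q1Q r1T e1]]] := rep 1%N.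
have r0n := r_neq0 _ _ _ q0Q e0.
have q_neq0 q : (0 < q <= Q)%N -> q%:R != 0 :> rat.
  by case/andP=> q_gt0 _; rewrite pnatr_eq0 -lt0n.
pose R0 : rat := r0%:~R / q0%:R; pose rho : rat := (r1%:~R / q1%:R) / R0.
have R0n : R0 != 0 by rewrite mulf_neq0 ?invr_eq0 ?intr_eq0 ?q_neq0.
have bound (r r' : int) (q q' : nat) : (`|r| <= T)%N -> (`|r'| <= T)%N ->
    (q <= Q)%N -> (q' <= Q)%N -> (`|(r * r' * (q%:Z * q'%:Z))%R| <= T ^ 2 * Q ^ 2)%N.
  by move=> rT r'T qQ q'Q; rewrite !abszM -!mulnn leq_mul // leq_mul.
have bound2 (x y : int) : (`|x| <= T ^ 2 * Q ^ 2)%N -> (`|y| <= T ^ 2 * Q ^ 2)%N ->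
    (`|x - y| < p)%N.
  by move: (T ^ 2 * Q ^ 2)%N QT_lt => N; lia.
(* Both cross products are at most T^2 Q^2 in size, so [QT_lt] lifts their congruence mod p to an
   equality of integers. *)
have rep_uniq B q r q' r' : (0 < q <= Q)%N -> (`|r| <= T)%N -> q%:R * B = r%:~R :> F ->
    (0 < q' <= Q)%N -> (`|r'| <= T)%N -> q'%:R * B = r'%:~R :> F ->
    r%:~R / q%:R = r'%:~R / q'%:R :> rat.
  move=> qQ rT e q'Q r'T e'; apply/eqP; rewrite eqr_div ?q_neq0 //.
  rewrite -[q%:R]/(q%:Z%:~R) -[q'%:R]/(q'%:Z%:~R) -!intrM eqr_int; apply/eqP/Fp_intr_eq.
    case/andP: qQ => _ qQ; case/andP: q'Q => _ q'Q.
    apply: bound2.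
      by have := bound r 1 q' 1%N rT T_gt0 q'Q Q_gt0; rewrite !mulr1.
    by have := bound r' 1 q 1%N r'T T_gt0 qQ Q_gt0; rewrite !mulr1.
  by rewrite !intrM -e -e' -!pmulrn mulrAC [RHS]mulrAC [q%:R * _]mulrC.
(* Two consecutive terms are carried along: with B_m = A g^m, the next one comes from B_(m+2) B_m =
   B_(m+1)^2. *)
have prog m : (exists q r, [/\ (0 < q <= Q)%N, (`|r| <= T)%N,
     q%:R * (A * g ^+ m) = r%:~R & r%:~R / q%:R = R0 * rho ^+ m]) /\
   (exists q r, [/\ (0 < q <= Q)%N, (`|r| <= T)%N,
     q%:R * (A * g ^+ m.+1) = r%:~R & r%:~R / q%:R = R0 * rho ^+ m.+1]).
  elim: m => [|m [[q [r [qQ rT e h]]] [q' [r' [q'Q r'T e' h']]]]].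
    split; first by exists q0, r0; split=> //; rewrite expr0 mulr1.
    by exists q1, r1; split=> //; rewrite expr1 [RHS]mulrC divfK.
  split; first by exists q', r'.
  have [q'' [r'' [q''Q r''T e'']]] := rep m.+2; exists q'', r''; split=> //.
  have key : r'' * r * (q'%:Z * q'%:Z) = r' * r' * (q''%:Z * q%:Z).
    apply: Fp_intr_eq.
      by apply: bound2; apply: bound => //; case/andP: qQ q'Q q''Q => _ qQ /andP [_ ?] /andP [_ ?].
    rewrite !intrM -e -e' -e'' -!pmulrn !exprS.
    have id (R : comNzRingType) (x x' x'' y z t : R) :
      x'' * (y * (z * (z * t))) * (x * (y * t)) * (x' * x') =
      x' * (y * (z * t)) * (x' * (y * (z * t))) * (x'' * x) by ring.
    exact: id.
  have rn : r%:~R / q%:R != 0 :> rat.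
    by rewrite mulf_neq0 ?invr_eq0 ?q_neq0 // intr_eq0 (r_neq0 _ _ _ qQ e).
  apply: (mulIf rn).
  have -> : r''%:~R / q''%:R * (r%:~R / q%:R) = (r'%:~R / q'%:R) * (r'%:~R / q'%:R) :> rat.
    rewrite !mulf_div; apply/eqP; rewrite eqr_div ?mulf_neq0 ?q_neq0 //.
    by have := congr1 (fun x : int => x%:~R : rat) key; rewrite !intrM -!pmulrn => ->.
  rewrite h h' !exprS; ring.
(* As g^a = 1, the progression is back at [R0] after a steps, so the rational [rho] is a root of
   unity. *)
have rho2 : rho ^+ 2 = 1.
  have [[q [r [qQ rT e h]]] _] := prog a.
  have := rep_uniq A q r q0 r0 qQ rT; rewrite h; move: e e0.
  rewrite ga expr0 mulr1 => e e0 /(_ e q0Q r0T e0) /eqP.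
  rewrite -/R0 -{2}[R0]mulr1 (inj_eq (mulfI R0n)) => /eqP rhoa.
  have : `|rho| ^+ a == 1 by rewrite -normrX rhoa normr1.
  by rewrite pexpr_eq1 ?normr_ge0 // => /eqP rho1; rewrite -real_normK ?num_real // rho1 expr1n.
(* Hence A g^2 and A are represented by the same fraction, against g^2 <> 1. *)
have [[q [r [qQ rT e h]]] _] := prog 2.
move/eqP: h; rewrite rho2 mulr1 eqr_div ?q_neq0 //.
rewrite -[q%:R]/(q%:Z%:~R) -[q0%:R]/(q0%:Z%:~R) -!intrM eqr_int => /eqP.
move/(congr1 (fun x : int => x%:~R : F)); rewrite !intrM -e -e0 -!pmulrn expr0 mulr1.
have qn (x : nat) : (0 < x <= Q)%N -> x%:R != 0 :> F.
  case/andP=> x0 xQ; apply: (natr_neq0_lt (pchar_Fp p_prime)).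
  by rewrite x0 (leq_ltn_trans xQ).
move=> eq; case/eqP: g2; apply: (mulfI (mulf_neq0 (mulf_neq0 (qn _ qQ) A0) (qn _ q0Q))).
by rewrite mulr1 mulrAC -[_ * _ * g ^+ 2]mulrA eq [RHS]mulrC [q%:R * A]mulrC mulrA.
Qed.

(** Pigeonhole: of the N + 1 multiples q B with 0 <= q <= N, two have representatives in the same
    interval of length p / N. *)
Lemma dirichlet_approximation (B : F) (N : nat) : (0 < N)%N ->
  exists q r, [/\ (0 < q <= N)%N, (`|r| * N < p)%N & q%:R * B = r%:~R].
Proof.
move=> N0.
pose v (q : nat) : nat := (q%:R * B : F).
have vp q : (v q < p)%N by apply: ltn_Fp.
have box_lt q : (v q * N %/ p < N)%N.
  by rewrite ltn_divLR ?prime_gt0 // mulnC ltn_pmul2l.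
pose box (q : 'I_N.+1) := Ordinal (box_lt q).
have [q1 [q2 [lt12 e12]]] : exists q1 q2 : 'I_N.+1, (q1 < q2)%N /\ box q1 = box q2.
  have /injectivePn [q1 [q2 ne e]] : ~~ injectiveb box.
    by apply/negP => /injectiveP /leq_card; rewrite !card_ord ltnn.
  by have [lt|lt|/val_inj eq] := ltngtP q1 q2; [exists q1, q2|exists q2, q1|rewrite eq eqxx in ne].
exists (q2 - q1)%N, ((v q2)%:Z - (v q1)%:Z); split.
- by have := ltn_ord q2; lia.
- have/(congr1 val) /= e := e12.
  have := divn_eq (v q1 * N) p; have := divn_eq (v q2 * N) p; rewrite e.
  have := ltn_pmod (v q1 * N) (prime_gt0 p_prime).
  have := ltn_pmod (v q2 * N) (prime_gt0 p_prime).
  move: (_ %% _)%N (_ %% _)%N (_ %/ _ * _)%N => s1 s2 s3 *; nia.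
- have vE q : (v q)%:R = q%:R * B by rewrite /v natr_Zp.
  by rewrite natrB ?(ltnW lt12) // mulrBl intrB -!pmulrn !vE.
Qed.

(* The multiples of r/q advance by steps shorter than the target window, and
   more than T of them fit into a full turn. *)
Lemma affine_hits_window (B c : F) (K : nat) : (p <= Q * K)%N ->
  (Q * (p %/ T.+1).+1 < K)%N -> ~~ small_height B ->
  exists t : nat, (t < K)%N /\ ((B * t%:R + c : F)%R < K)%N.
Proof.
move=> pQK QK large.
have [q [r [/andP [q0 qQ] rp e]]] := dirichlet_approximation B Q_gt0.
have rT : (T < `|r|)%N.
  rewrite ltnNge; apply: contra large => rT; apply/small_heightP.
  by exists q, r; rewrite q0 qQ.
have rK : (`|r| < K)%N by rewrite -(ltn_pmul2r Q_gt0); apply: leq_trans rp _; rewrite mulnC.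
have cp := ltn_Fp p_prime c.
have tau_lt tau : (tau <= (p %/ T.+1).+1)%N -> (q * tau < K)%N.
  by move=> le; apply: leq_ltn_trans QK; apply: leq_mul.
have r0 : (0 < `|r|)%N by apply: leq_ltn_trans rT.
have le_tau m : (m <= p)%N -> (m %/ `|r| <= p %/ T.+1)%N.
  by move=> mp; apply: leq_trans (leq_div2r _ mp) _; apply: leq_div2l.
have val_small m : (m < p)%N -> (m%:R : F) = m :> nat.
  by move=> mp; rewrite val_Fp_nat // modn_small.
have cE : c = (c : nat)%:R by rewrite natr_Zp.
case: (lerP 0 r) => rs.
  (* Going up from c by steps |r|, [tau] is the first step to reach p; subtracting p leaves less
     than |r|. *)
  pose tau := ((p - c - 1) %/ `|r|).+1; exists (q * tau)%N; split.
    by apply: tau_lt; rewrite ltnS le_tau //; lia.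
  have rE : r%:~R = (`|r|%N)%:R :> F by rewrite -{1}(gez0_abs rs).
  have lt1 := ltn_ceil (p - c - 1) r0.
  have le1 := leq_trunc_div (p - c - 1) `|r|.
  have -> : B * (q * tau)%:R + c = (c + `|r| * tau - p)%:R.
    rewrite natrB ?natrD; last by rewrite /tau mulnC; lia.
    by rewrite pchar_Fp_0 // subr0 -cE natrM mulrA [B * _]mulrC e rE -natrM addrC.
  have lt2 : (c + `|r| * tau - p < `|r|)%N by rewrite /tau mulnC mulSn; lia.
  rewrite val_small; first exact: ltn_trans lt2 rK.
  by apply: ltn_trans lt2 _; apply: leq_ltn_trans rp; rewrite leq_pmulr.
(* Going down, [tau] steps lead from c to c mod |r|. *)
pose tau := (c %/ `|r|)%N; exists (q * tau)%N; split.
  by apply: tau_lt; rewrite ltnW // ltnS le_tau // ltnW.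
have rE : r%:~R = - (`|r|%N)%:R :> F by rewrite -{1}[r]opprK -(ltz0_abs rs) intrN.
have cF : c = (`|r| * tau)%:R + (c %% `|r|)%:R.
  by rewrite -natrD mulnC -divn_eq natr_Zp.
have -> : B * (q * tau)%:R + c = (c %% `|r|)%:R.
  by rewrite natrM mulrA [B * _]mulrC e rE mulNr -natrM [X in _ + X]cF addKr.
have lt2 := ltn_pmod c r0.
rewrite val_small; first exact: ltn_trans lt2 rK.
by apply: ltn_trans lt2 _; apply: leq_ltn_trans rp; rewrite leq_pmulr.
Qed.

(** For each t exactly K shifts c bring B t + c into [0, K), so the mean of the counts over c is K^2
    / p. *)
Lemma exists_popular_shift (B : F) (K : nat) : (K <= p)%N ->
  exists c : F, (K * K <= p * #|[pred t : 'I_K | ((B * t%:R + c : F)%R < K)%N]|)%N.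
Proof.
move=> Kp; pose N (c : F) := #|[pred t : 'I_K | ((B * t%:R + c : F)%R < K)%N]|.
have val_small (t : 'I_K) : (t%:R : F) = t :> nat.
  by rewrite val_Fp_nat // modn_small // (leq_trans (ltn_ord t)).
have cardK : #|[pred s : F | (s < K)%N]| = K.
  rewrite -[RHS]card_ord -(card_imset _ (f := fun t : 'I_K => t%:R : F)); last first.
    by move=> t t' /(congr1 (@nat_of_ord _)); rewrite !val_small => /val_inj.
  apply: eq_card => s; rewrite inE; apply/idP/imsetP => [sK|[t _ ->]].
    by exists (Ordinal sK) => //=; rewrite natr_Zp.
  by rewrite val_small.
have sumE : (\sum_(c : F) N c = K * K)%N.
  under eq_bigr do rewrite /N -sum1_card big_mkcond /=.
  rewrite exchange_big /= -[in RHS](card_ord K) -sum_nat_const.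
  apply: eq_bigr => t _; rewrite -big_mkcond /= [RHS]card_ord -[RHS]cardK -[RHS]sum1_card.
  by rewrite [RHS](reindex_inj (addrI (B * t%:R))).
case: (pickP (fun c : F => K * K <= p * N c)%N) => [c|none]; first by exists c.
have : (\sum_(c : F) (p * N c).+1 <= \sum_(c : F) K * K)%N.
  by apply: leq_sum => c _; rewrite ltnNge none.
under eq_bigr do rewrite -addn1.
rewrite big_split /= -big_distrr /= sumE !sum_nat_const card_Fp // muln1.
by rewrite -[leqRHS]addn0 leq_add2l leqNgt prime_gt0.
Qed.

End Heights.

(** The extra K keeps the multiplier of n positive despite the subtraction, which matters when l =
    0. *)
Lemma window_range (p n K l u u1 u2 : nat) : (4 * (n * K) <= p)%N -> (l < n)%N ->
  (u < K)%N -> (u1 < K)%N -> (u2 < K)%N -> (0 < l + n * (K + u + u1 - u2) < p)%N.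
Proof.
move=> nK ln uK u1K u2K; have n0 : (0 < n)%N by apply: leq_ltn_trans ln.
have [pos lt] : (0 < K + u + u1 - u2)%N /\ (K + u + u1 - u2 < 4 * K)%N.
  by clear -uK u1K u2K; lia.
rewrite addn_gt0 muln_gt0 n0 pos orbT /=.
apply: leq_trans nK; rewrite mulnCA.
apply: (@leq_trans (n * (K + u + u1 - u2).+1)); first by rewrite mulnS ltn_add2r.
by rewrite leq_mul2l lt orbT.
Qed.

(** * From character sums to points in the two residue classes *)

Section Hitting.

Variables (p n k i j : nat) (A : 'F_p) (zeta : algC).
Hypotheses (p_prime : prime p) (zeta_prim : p.-primitive_root zeta).
Hypotheses (p_odd : odd p) (A_neq0 : A != 0).
Hypotheses (i_lt : (i < n)%N) (j_lt : (j < n)%N).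
Local Notation F := 'F_p.

Definition hits := exists X Y : nat, [/\ (0 < i + n * X < p)%N, (0 < j + n * Y < p)%N &
  A * (i + n * X)%:R ^+ k = (j + n * Y)%:R :> F].

Lemma hits_of_sparse (r L : nat) : (2 < p)%N -> coprime k (p - 1) -> (n < p)%N ->
  (0 < L)%N -> (2 * (n * L) <= p)%N ->
  (p ^ 10 * r.+1 < (p - 1) ^ 3 * L ^ 8)%N ->
  (forall s : F, s != 0 -> (#|ratio_set k s| <= r)%N) -> hits.
Proof.
move=> p2 kc np L0 nLp big ratio_le.
have n_gt0 : (0 < n)%N by apply: leq_ltn_trans i_lt.
have nL : (n * L < p)%N.
  by have : (0 < n * L)%N; [rewrite muln_gt0 n_gt0 | move: nLp; lia].
have n0p : (0 < n < p)%N by rewrite n_gt0.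
(* Starting from i + n and j + n keeps both points positive when i or j is 0. *)
have [x [t [s [tL sL x0 xE yE]]]] := hit_of_ratio_bound p_prime p2 kc p_odd A_neq0
  ratio_le zeta_prim (i + n) (j + n) n0p L0 nL big.
have shift (l u : nat) : (l < n)%N -> (u.+1 < 2 * L)%N -> (0 < l + n * u.+1 < p)%N.
  move=> ln uL; rewrite addn_gt0 muln_gt0 n_gt0 orbT /=.
  apply: leq_trans nLp; apply: (@leq_trans (n * u.+2)).
    by rewrite [X in (_ <= X)%N]mulnS ltn_add2r.
  by rewrite mulnCA leq_mul2l uL orbT.
exists t.+1, s.+1; split; [exact: shift|exact: shift|].
by rewrite !mulnS !addnA -xE yE.
Qed.

(** On the fiber x^(k-1) = g^m the map is x -> B x. A suitable point (z, B z), possibly off the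
    fiber, is moved into it by n (t1 - t2); as B t1 + c and B t2 + c are both small, the image also
    moves by a short multiple of n. *)
Lemma hits_of_dense (a K Q T : nat) :
  (0 < k)%N -> (0 < a)%N -> (p - 1 %| k.-1 * a)%N -> ~~ (p - 1 %| k.-1 * 2)%N ->
  (0 < Q)%N -> (0 < T)%N -> (2 * (T ^ 2 * Q ^ 2) < p)%N ->
  (p <= Q * K)%N -> (Q * (p %/ T.+1).+1 < K)%N -> (4 * (n * K) <= p)%N ->
  (forall H N, (p - 1 <= a * H)%N -> (K * K <= p * N)%N -> (p ^ 3 < (H * N) ^ 2)%N) ->
  hits.
Proof.
move=> k0 a0 adiv ndiv2 Q0 T0 QT pQK QK nK big.
have n0 : (0 < n)%N by apply: leq_ltn_trans i_lt.
have K0 : (0 < K)%N by apply: leq_ltn_trans QK.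
have [g0 g00 g2] := exists_power_sqr_neq1 p_prime ndiv2.
set g := g0 ^+ k.-1 in g2.
have ga : g ^+ a = 1.
  rewrite /g -exprM; case/dvdnP: adiv => c ->.
  by rewrite [(c * _)%N]mulnC exprM Fp_expr_pred // expr1n.
have [m large] := exists_large_height p_prime Q0 T0 QT a0 A_neq0 ga g2.
set B := A * g ^+ m in large.
have fib : power_fiber k.-1 (g ^+ m) (g0 ^+ m).
  by apply/andP; split; [rewrite expf_neq0 | rewrite exprAC].
have nKp : (n * K < p)%N.
  by apply: leq_trans nK; rewrite ltn_Pmull // muln_gt0 n0.
have np : (n < p)%N by apply: leq_ltn_trans nKp; rewrite leq_pmulr.
have nF : n%:R != 0 :> F by apply: (natr_neq0_lt (pchar_Fp p_prime)); rewrite n0.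
have Kp : (K <= p)%N by apply: leq_trans (ltnW nKp); rewrite leq_pmull.
(* With this shift, B t + c0 = s means B (i + n K + n t) = j + n K + n s; the offset n K leaves room
   for the later subtractions. *)
pose c0 : F := (B * (i + n * K)%:R - (j + n * K)%:R) / n%:R.
have [t [tK sK]] := affine_hits_window p_prime Q0 T0 QT c0 pQK QK large.
set s := nat_of_ord (B * t%:R + c0 : F)%R in sK.
have sE : B * (i + n * K + n * t)%:R = (j + n * K + n * s)%:R.
  rewrite [in RHS]natrD [in RHS]natrM natr_Zp [in RHS]mulrDr /c0 [n%:R * (_ / _)]mulrC.
  rewrite divfK // [in LHS]natrD [(n * t)%:R]natrM mulrDr [B * (n%:R * _)]mulrCA.
  by rewrite [RHS]addrCA [_ + (_ - _)]addrC subrK addrC.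
have [c cE] := exists_popular_shift p_prime B Kp.
pose P := [pred u : 'I_K | ((B * u%:R + c : F)%R < K)%N].
have HP := big _ _ (leq_trans (card_power_kernel p_prime a0 adiv)
  (leq_mul (leqnn a) (card_power_fiber_ge fib))) cE.
have n0p : (0 < n < p)%N by rewrite n0.
have nonempty : exists x, power_fiber k.-1 (g ^+ m) x by exists (g0 ^+ m).
have [x [t1 [t2 [dx P1 P2 xE]]]] := hit_of_power_fiber p_prime zeta_prim
  (i + n * K + n * t)%:R nonempty n0p nKp HP.
pose s1 := nat_of_ord (B * t1%:R + c : F)%R; pose s2 := nat_of_ord (B * t2%:R + c : F)%R.
have castE (l u u1 u2 : nat) : (u2 < K)%N -> (l + n * (K + u + u1 - u2))%:R =
    (l + n * K + n * u)%:R + (n * u1)%:R - (n * u2)%:R :> F.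
  move=> u2K; apply/eqP; rewrite -subr_eq0 opprB addrA subr_eq add0r -!natrD; apply/eqP.
  congr _%:R; rewrite -addnA -mulnDr subnK ?mulnDr ?addnA //.
  by apply: leq_trans (ltnW u2K) _; rewrite -addnA leq_addr.
exists (K + t + t1 - t2)%N, (K + s + s1 - s2)%N; split; try exact: window_range.
rewrite !castE // -xE.
have xk : x ^+ k = g ^+ m * x.
  by case/andP: dx => _ /eqP <-; rewrite -exprSr prednK.
rewrite xk mulrA -/B xE mulrBr mulrDr sE !natrM !natr_Zp.
have id (R : comNzRingType) (y b z u v w : R) :
  y + b * (z * u) - b * (z * v) = y + z * (b * u + w) - z * (b * v + w) by ring.
exact: id.
Qed.

End Hitting.

(** * Numerical conditions and choice of parameters *)

Lemma leq_expM (x y e : nat) : (x <= y)%N -> (x ^ e <= y ^ e)%N.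
Proof. by move=> xy; case: e => [|e]; rewrite ?expn0 ?leq_exp2r. Qed.

(** From p <= 10 M H and p <= 64 n^2 N follows p^2 <= 640 M n^2 H N; squaring and using (640 M
    n^2)^2 < p gives the claim. *)
Lemma dense_size_bound (p n M K a H N : nat) : (1 < p)%N -> (8 * n <= p)%N ->
  (a < 5 * M)%N -> (p < 4 * (n * K.+1))%N -> ((640 * (M * n ^ 2)) ^ 2 < p)%N ->
  (p - 1 <= a * H)%N -> (K * K <= p * N)%N -> (p ^ 3 < (H * N) ^ 2)%N.
Proof.
move=> p1 np aM pK cp aH KN.
have le1 : (p <= 10 * M * H)%N.
  have : (a * H <= 5 * M * H)%N by rewrite leq_mul2r ltnW ?orbT.
  by rewrite -!mulnA; move: (M * H)%N (a * H)%N aH => x y; lia.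
have le2 : (p <= 64 * n ^ 2 * N)%N.
  have p8 : (p <= 8 * (n * K))%N by move: pK; rewrite mulnS; lia.
  rewrite -(@leq_pmul2l p) ?(ltnW p1) //; apply: leq_trans (leq_mul p8 p8) _.
  have -> : (8 * (n * K) * (8 * (n * K)) = 64 * n ^ 2 * (K * K))%N by ring.
  by rewrite [leqRHS]mulnCA leq_mul2l KN orbT.
have p0 : (0 < p)%N by apply: ltnW.
have le3 : (p ^ 3 * p <= (640 * (M * n ^ 2)) ^ 2 * (H * N) ^ 2)%N.
  rewrite -expnMn -expnSr (expnM p 2 2); apply: leq_expM.
  have -> : (640 * (M * n ^ 2) * (H * N) = 10 * M * H * (64 * n ^ 2 * N))%N by ring.
  by rewrite -mulnn leq_mul.
rewrite ltnNge; apply/negP => le4.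
have := leq_trans le3 (leq_mul (leqnn _) le4).
by rewrite mulnC leq_pmul2r ?expn_gt0 ?p0 // leqNgt cp.
Qed.

(** Since p <= 2 (p - 1) and p <= 4 n L, the constant is 2^3 4^8 = 2^19. *)
Lemma sparse_size_bound (p n L r : nat) : (1 < p)%N -> (0 < n)%N -> (p <= 4 * (n * L))%N ->
  (2 ^ 19 * n ^ 8 * r.+1 < p)%N -> (p ^ 10 * r.+1 < (p - 1) ^ 3 * L ^ 8)%N.
Proof.
move=> p1 n0 pL rp.
have c0 : (0 < 2 ^ 19 * n ^ 8)%N by rewrite muln_gt0 !expn_gt0 n0.
rewrite -(ltn_pmul2l c0).
apply: (@leq_trans (p ^ 3 * p ^ 8)).
  rewrite -expnD (expnSr p 10) mulnCA ltn_pmul2l //.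
  by rewrite expn_gt0 (ltnW p1).
have -> : (2 ^ 19 * n ^ 8 * ((p - 1) ^ 3 * L ^ 8) = (2 * (p - 1)) ^ 3 * (4 * (n * L)) ^ 8)%N.
  have -> : (2 ^ 19 = 2 ^ 3 * 4 ^ 8)%N by rewrite -[4%N]/(2 ^ 2)%N -expnM -expnD.
  by rewrite !expnMn; ring.
by rewrite leq_mul // leq_expM //; lia.
Qed.

Lemma hits_of_large_prime (p n k i j : nat) (A : 'F_p) : prime p -> odd p -> (1 < n)%N ->
  (0 < k < p - 1)%N -> coprime k (p - 1) -> k != 1%N -> k != ((p + 1) %/ 2)%N ->
  (4 * 10 ^ 29 * n ^ 61 < p)%N -> A != 0 -> (i < n)%N -> (j < n)%N ->
  hits n k i j A.
Proof.
move=> p_prime p_odd n1 /andP [k0 kp] kc k1 khalf p_large A0 i_lt j_lt.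
have [zeta zeta_prim] := C_prim_root_exists (prime_gt0 p_prime).
have n0 : (0 < n)%N by apply: ltnW.
have lt_p c e : (c <= 4 * 10 ^ 29)%N -> (e <= 61)%N -> (c * n ^ e < p)%N.
  by move=> cle ele; apply: leq_ltn_trans p_large; rewrite leq_mul // leq_pexp2l.
have [b6 b16 b20] : [/\ (6 * 10 ^ 7 * n ^ 8 < p)%N, (6 * 10 ^ 14 * n ^ 16 < p)%N &
    (20 * n ^ 1 < p)%N].
  by split; apply: lt_p; lia.
have [b6' b48 bdense] : [/\ (8 * 10 ^ 4 * n ^ 6 < p)%N, (48 * n ^ 2 < p)%N &
    (640 ^ 2 * 10 ^ 14 * n ^ 20 < p)%N].
  by split; apply: lt_p; lia.
have [b2 b20' b32] : [/\ (2 * n ^ 0 < p)%N, (2 ^ 20 * n ^ 8 < p)%N &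
    (2 ^ 19 * 51 * 10 ^ 21 * n ^ 32 < p)%N].
  by split; apply: lt_p; lia.
clear lt_p p_large.
have p2 : (2 < p)%N by move: b2; rewrite expn0 muln1.
(* This brings Stepanov's bound 2 p / M below p / (2^19 n^8), as 2^20 < 10^7. *)
pose M := (10 ^ 7 * n ^ 8)%N.
have N8 : (0 < n ^ 8)%N by rewrite expn_gt0 n0.
have M0 : (0 < M)%N by rewrite muln_gt0 !expn_gt0 n0.
have M1 : (5 * M < p - 1)%N by rewrite /M; move: b6 N8; move: (n ^ 8)%N; clear; lia.
have M2 : (5 * M * M < p - 1)%N.
  have -> : (5 * M * M = 5 * 10 ^ 14 * n ^ 16)%N.
    by rewrite /M (expnD n 8 8); move: (n ^ 8)%N; clear; lia.
  have : (0 < n ^ 16)%N by rewrite expn_gt0 n0.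
  by move: b16; move: (n ^ 16)%N; clear; lia.
have [[a /andP [a0 aM] ka]|ratio_le] := ratio_set_bound p_prime p2 kc M0 M1 M2.
  (* With K close to p / 4n, Q = 5 n gives Q K >= p, and T = 40 n^2 makes Q p / T = p / 8n, about
     half of K. *)
  pose K := (p %/ (4 * n))%N.
  have K1 : (4 * (n * K) <= p)%N by rewrite mulnA mulnC leq_trunc_div.
  have K2 : (p < 4 * (n * K.+1))%N by rewrite mulnA mulnC ltn_ceil // muln_gt0.
  have p20 : (20 * n < p)%N by rewrite -[n]expn1.
  apply: (@hits_of_dense p n k i j A zeta p_prime zeta_prim A0 i_lt j_lt
     a K (5 * n) (40 * n ^ 2) k0 a0).
  - have : (k.-1 * a + a = 0 + a %[mod p - 1])%N by rewrite add0n -mulSnr prednK.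
    by move/eqP; rewrite eqn_modDr mod0n.
  (* As 2 (k - 1) < 2 (p - 1), the quotient can only be 0 or 1, that is k = 1 or k = (p + 1) / 2. *)
  - apply/negP => /dvdnP [[|[|c]] e].
    + by move/eqP: k1; apply; move: e k0; clear; lia.
    + move/eqP: khalf; apply.
      have -> : (p + 1 = k * 2)%N by move: e k0 p2; clear; lia.
      by rewrite mulnK.
    + by move: e kp; rewrite !mulSn; move: (c * _)%N; clear; lia.
  - by rewrite muln_gt0.
  - by rewrite muln_gt0 expn_gt0 n0.
  - have -> : (2 * ((40 * n ^ 2) ^ 2 * (5 * n) ^ 2) = 8 * 10 ^ 4 * n ^ 6)%N; last exact: b6'.
    by clear; rewrite !expnMn; ring.
  - by move: K2 p20; rewrite -mulnA mulnS; move: (n * K)%N; clear; lia.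
  - have D1 := leq_trunc_div p (40 * n ^ 2).+1.
    rewrite ltnNge; apply/negP; move: D1; move: (p %/ _)%N => D D1 KD.
    have : (8 * n * K <= 8 * n * (5 * n * D.+1))%N by rewrite leq_mul2l KD orbT.
    have -> : (8 * n * (5 * n * D.+1) = 40 * (D * n ^ 2) + 40 * n ^ 2)%N by clear; ring.
    have nn : (n <= n ^ 2)%N by rewrite -mulnn leq_pmulr.
    move: b48 D1 K2 nn; rewrite !mulnS -!mulnA mulnCA.
    by move: (n * K)%N (D * n ^ 2)%N (n ^ 2)%N; clear; lia.
  - exact: K1.
  - move=> H N aH KN; apply: (dense_size_bound _ _ aM K2 _ aH KN).
    + exact: ltnW p2.
    + by move: p20; clear; lia.
    + have -> : ((640 * (M * n ^ 2)) ^ 2 = 640 ^ 2 * 10 ^ 14 * n ^ 20)%N; last exact: bdense.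
      by rewrite /M (expnM 10 7 2); move: 640%N (10 ^ 7)%N; clear; move=> *; ring.
pose L := (p %/ (2 * n))%N.
have p2n : (2 * n <= p)%N by move: b20; rewrite expn1; clear; lia.
have L0 : (0 < L)%N by rewrite divn_gt0 // muln_gt0.
have L1 : (2 * (n * L) <= p)%N by rewrite mulnA mulnC leq_trunc_div.
have L2 : (p < 2 * (n * L.+1))%N by rewrite mulnA mulnC ltn_ceil // muln_gt0.
(* The maximum covers both outcomes of [ratio_set_bound]; with M^3 = 10^21 n^24, the second asks for
   p of order n^32. *)
apply: (@hits_of_sparse p n k i j A zeta p_prime zeta_prim p_odd A0 i_lt j_lt
   (maxn (2 * p %/ M) (50 * M ^ 3)) L p2 kc _ L0 L1).
- by move: p2n n0; clear; lia.
- apply: sparse_size_bound; first exact: ltnW p2.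
  + exact: n0.
  + have : (n <= n * L)%N by rewrite leq_pmulr.
    by move: L2; rewrite mulnS; move: (n * L)%N; clear; lia.
  have [_|_] := leqP (2 * p %/ M) (50 * M ^ 3).
    have -> : (2 ^ 19 * n ^ 8 * (50 * M ^ 3).+1 =
       2 ^ 19 * 50 * 10 ^ 21 * n ^ 32 + 2 ^ 19 * n ^ 8)%N.
      rewrite /M expnMn -!expnM (expnD n 8 24).
      by move: (n ^ 8)%N (n ^ (8 * 3))%N; clear; lia.
    have : (n ^ 8 <= n ^ 32)%N by rewrite leq_pexp2l.
    by move: b32 N8; move: (n ^ 8)%N (n ^ 32)%N; clear; lia.
  have := leq_trunc_div (2 * p) M; move: (_ %/ M)%N => r.
  have -> : (r * M = 10 ^ 7 * (n ^ 8 * r))%N by rewrite /M mulnC mulnA.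
  have -> : (2 ^ 19 * n ^ 8 * r.+1 = 2 ^ 19 * (n ^ 8 * r) + 2 ^ 19 * n ^ 8)%N.
    by rewrite mulnS addnC mulnA.
  by move: b20'; move: (n ^ 8 * r)%N (n ^ 8)%N; clear; lia.
- move=> s s0; rewrite leq_max leq_divRL //.
  by apply/orP; have [h|h] := ratio_le s s0; [left|right].
Qed.

(* Transfer from F_p to the integers *)
Require Import Defs.
From mathcomp Require Import all_boot all_order all_algebra.
From mathcomp Require Import all_classical all_reals all_analysis.

Import Order.TTheory GRing.Theory Num.Theory.

Local Open Scope classical_set_scope.
Local Open Scope ring_scope.

Theorem theorem1p4 (R : realType) (p n : nat) (A : int) (k : nat)
  (p_prime : prime p) (p_odd : odd p)
  (n_ge2 : (2 <= n)%N)
  (A_small : `|A|%:~R < p%:R / 2 :> R)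
  (A_ndiv : ~~ (p%:Z %| A)%Z)
  (k_bounds : (1 <= k < p - 1)%N)
  (k_coprime : gcdn k (p - 1) = 1%N)
  (k_neq1 : k <> 1%N)
  (k_neqhalf : k <> ((p + 1) %/ 2)%N)
  (p_large : 4 * 10 ^+ 29 * (n%:R `^ (184 / 3)) < p%:R :> R) :
  forall i j : nat, (i <= n - 1)%N -> (j <= n - 1)%N ->
    (powmap p A k @` residue_class p n i) `&` residue_class p n j !=set0.
Proof.
move=> i j i_le j_le.
have n_gt0 : (0 < n)%N by apply: leq_trans n_ge2.
have lt_n l : (l <= n - 1)%N -> (l < n)%N by rewrite subn1 -ltnS prednK.
have Fp_int0 (x : int) : (x%:~R == 0 :> 'F_p) = (p%:Z %| x)%Z.
  rewrite dvdzE absz_nat (dvdn_pcharf (pchar_Fp p_prime)).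
  by case: x => m; rewrite ?NegzE ?abszN ?intrN ?oppr_eq0.
have A_neq0 : A%:~R != 0 :> 'F_p by rewrite Fp_int0.
(* Here 61 is the integer part of 184/3. *)
have p_large_nat : (4 * 10 ^ 29 * n ^ 61 < p)%N.
  rewrite -(ltr_nat R); apply: le_lt_trans p_large.
  rewrite natrM [(4 * _)%:R]natrM [(10 ^ 29)%:R]natrX [(n ^ 61)%:R]natrX.
  rewrite ler_wpM2l ?mulr_ge0 ?exprn_ge0 ?ler0n //.
  rewrite -powR_mulrn ?ler0n // ler_powR ?ler1n //.
  by rewrite ler_pdivlMr ?ltr0n // -natrM ler_nat.
have [X [Y [Xrange Yrange e]]] := hits_of_large_prime p_prime p_odd n_ge2 k_bounds
  (introT eqP k_coprime) (introN eqP k_neq1) (introN eqP k_neqhalf)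
  p_large_nat A_neq0 (lt_n _ i_le) (lt_n _ j_le).
have in_class l Z : (0 < l + n * Z < p)%N -> residue_class p n l (l + n * Z)%N%:Z.
  move=> range; split.
    by rewrite lez_nat; lia.
  by rewrite PoszD PoszM addrC [_ * Z%:Z]mulrC modzMDl.
exists (j + n * Y)%N%:Z; split; last exact: in_class.
exists (i + n * X)%N%:Z; first exact: in_class.
(* The target lies in [0, p), so it is its own residue and a congruence mod p suffices. *)
rewrite /powmap -[RHS](@modz_small _ p%:Z); last by case/andP: Yrange => _; rewrite ltz_nat.
apply/eqP; rewrite eqz_mod_dvd -Fp_int0 intrB intrM rmorphXn /= -!pmulrn e subrr.
by [].
Qed.
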